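(* Let $C$ be either a polytopal complex in $\mathbb{R}^d$ with $d\ge 3$, or a simplicial complex in $\mathbb{R}^2$ (in which case $d=2$). If the underlying space $|C|$ is star-shaped, then the $(d-2)$-nd iterated derived subdivision $\operatorname{sd}^{d-2}C$ is non-evasive, and in particular collapsible.
   Context: A polytopal complex in $\mathbb{R}^d$ is a finite collection of convex polytopes closed under taking faces such that any two intersect in a common face; $|C|$ is the union of its faces. A set $X\subset\mathbb{R}^d$ is star-shaped if there is $x\in X$ with $[x,y]\subset X$ for all $y\in X$. A derived subdivision $\operatorname{sd}C$ of a polytopal $d$-complex is obtained by stellarly subdividing (inserting a new vertex in the relative interior and coning) first all $d$-faces, then all $(d-1)$-faces, etc.; it is a simplicial complex combinatorially equivalent to the order complex of the poset of nonempty faces. $\operatorname{sd}^0C=C$, $\operatorname{sd}^{r+1}C=\operatorname{sd}(\operatorname{sd}^rC)$. An elementary collapse removes a free face, i.e. a nonempty face strictly contained in exactly one other face; a complex is collapsible if a sequence of elementary collapses reduces it to a single vertex. A $0$-dimensional simplicial complex is non-evasive iff it is a single point; a simplicial complex of positive dimension is non-evasive iff it has a vertex $v$ such that both the link of $v$ and the deletion of $v$ (the subcomplex of faces not containing $v$) are non-evasive. *)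

(* Defs.v *)
From HB Require Import structures.
From mathcomp Require Import all_boot all_order all_algebra.
From mathcomp Require Import finmap.
From mathcomp Require Import boolp classical_sets reals.

Set Implicit Arguments.
Unset Strict Implicit.
Unset Printing Implicit Defensive.

Import Order.TTheory GRing.Theory Num.Theory.
Local Open Scope ring_scope.

Section Geometry.
Variables (R : realType) (d : nat).
Local Notation pt := 'rV[R]_d.

Definition dotp (x y : pt) : R := \sum_(i < d) x 0 i * y 0 i.

Definition conv (S : seq pt) : set pt :=
  fun x => exists w : 'I_(size S) -> R,
    (forall i, 0 <= w i) /\ \sum_i w i = 1 /\
    x = \sum_i w i *: nth 0 S i.

Definition polytope (P : set pt) : Prop := exists S : seq pt, P = conv S.

Definition aff_indep (S : seq pt) : Prop :=
  forall w : 'I_(size S) -> R,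
    \sum_i w i = 0 -> \sum_i w i *: nth 0 S i = 0 -> forall i, w i = 0.

Definition simplex (P : set pt) : Prop :=
  exists S : seq pt, aff_indep S /\ P = conv S.

(* F is a face of P: the intersection of P with a supporting hyperplane
   {x | <c,x> = b} where <c,x> <= b on P (c = 0 gives P and the empty face) *)
Definition face_of (F P : set pt) : Prop :=
  exists (c : pt) (b : R), (forall x, P x -> dotp c x <= b) /\
    F = (fun x => P x /\ dotp c x = b).

Definition polytopal_complex (C : {fset set pt}) : Prop :=
  [/\ forall P, P \in C -> polytope P,
      forall P F, P \in C -> face_of F P -> F <> set0 -> F \in C &
      forall P Q, P \in C -> Q \in C ->
        face_of (setI P Q) P /\ face_of (setI P Q) Q].

Definition simplicial_complex (C : {fset set pt}) : Prop :=
  polytopal_complex C /\ forall P, P \in C -> simplex P.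

Definition underlying (C : {fset set pt}) : set pt :=
  fun x => exists2 P, P \in C & P x.

Definition star_shaped (X : set pt) : Prop :=
  exists2 x, X x & forall y, X y ->
    forall t : R, 0 <= t <= 1 -> X ((1 - t) *: x + t *: y).

End Geometry.

(* Abstract simplicial complexes over a choiceType V: finite families  *)
(* of nonempty finite vertex sets (the faces).                         *)

Section Abstract.
Variable V : choiceType.
Local Open Scope fset_scope.

Definition asc := {fset {fset V}}.

Definition order_complex (P : {fset V}) (le : V -> V -> Prop) : asc :=
  [fset c in fpowerset P | (c != fset0) &&
     asbool (forall x y, x \in c -> y \in c -> le x y \/ le y x)].

Definition deletion (K : asc) (v : V) : asc := [fset s in K | v \notin s].
Definition link (K : asc) (v : V) : asc :=
  [fset s in K | (v \notin s) && (v |` s \in K)].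

Definition is_vertex (K : asc) (v : V) : bool := [fset v] \in K.

Definition pos_dim (K : asc) : Prop := exists2 s, s \in K & (1 < #|` s|)%N.

Inductive nonevasive : asc -> Prop :=
| nonevasive_point v : nonevasive [fset [fset v]]
| nonevasive_step K v : is_vertex K v -> pos_dim K ->
    nonevasive (link K v) -> nonevasive (deletion K v) -> nonevasive K.

Definition elem_collapse (K K' : asc) : Prop :=
  exists s t, [/\ s \in K, t \in K, s != fset0 /\ fproper s t,
    (forall r, r \in K -> fproper s r -> r = t) &
    K' = K `\` [fset s; t]].

Inductive collapses : asc -> asc -> Prop :=
| collapses_refl K : collapses K K
| collapses_step K K' K'' : elem_collapse K K' -> collapses K' K'' -> collapses K K''.

Definition collapsible (K : asc) : Prop := exists v, collapses K [fset [fset v]].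

End Abstract.

Definition sd (V : choiceType) (K : asc V) := order_complex K (fun s t => fsubset s t).

Fixpoint sd_holds (P : forall V : choiceType, asc V -> Prop) (r : nat)
  (V : choiceType) (K : asc V) {struct r} : Prop :=
  match r with
  | 0 => P V K
  | r'.+1 => sd_holds P r' (sd K)
  end.

Definition nonevasive_and_collapsible (V : choiceType) (K : asc V) : Prop :=
  nonevasive K /\ collapsible K.

Section Combinatorial_types.
Variables (R : realType) (d : nat).
Local Notation pt := 'rV[R]_d.
Local Open Scope fset_scope.

(* combinatorial type of sd C for a polytopal complex C: order complex of the
   poset of nonempty faces of C ordered by inclusion *)
Definition sd_polytopal (C : {fset set pt}) : asc (set pt) :=
  order_complex [fset P in C | P != set0] (fun P Q => subset P Q).

(* combinatorial type of a geometric simplicial complex C: its vertex scheme,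
   vertices being the 0-faces {p} of C, each nonempty simplex P giving the
   set of 0-faces of C contained in P *)
Definition vertex_scheme (C : {fset set pt}) : asc (set pt) :=
  [fset [fset Q in C | asbool ((exists p, Q = set1 p) /\ subset Q P)]
    | P in C & P != set0].

End Combinatorial_types.

(* Main.v *)
Require Import Defs.
From HB Require Import structures.
From mathcomp Require Import all_boot all_order all_algebra.
From mathcomp Require Import finmap.
From mathcomp Require Import boolp classical_sets reals.
From mathcomp Require topology normedtype derive.
From mathcomp Require Import zify ring lra.

(** A stronger fact holds: in any dimension the order complex of the nonempty
    cells of a complex with star-shaped union is already nonevasive, and
    subdividing preserves nonevasiveness.  Let x be a star center, p(P) the
    point of the cell P nearest to x, and c(P) the least cell containing p(P).
    Remove the cells by decreasing distance to x, and among the cells with the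
    same c the cell c itself last.  If P differs from c(P), its link is a cone
    with apex c(P) when P is removed.  If T = c(T), with p = p(T) and n = x - p,
    the link of T at its removal consists of the cells containing T that meet
    the open half space <y - p, n> > 0; cutting their tangent cones at p by the
    hyperplane <y, n> = 1 realizes it as a polyhedral complex with star center
    n / <n, n>, so induction applies.  Allowing unbounded cells is what makes
    the induction work.

    For a simplicial complex K in the plane, this gives that sd K is
    nonevasive, hence K is connected and has Euler characteristic 1.  Order the
    vertices lexicographically; every upper and every lower link, being ordered
    by angle, is a disjoint union of paths.  Counting faces at their least and
    at their greatest vertices gives
      sum_v ((1 - chi (upper link)) + (1 - chi (lower link))) = 2 chi K = 2,
    so some vertex has a path as its whole link; remove it and iterate. *)

Set Implicit Arguments.
Unset Strict Implicit.
Unset Printing Implicit Defensive.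

Import Order.TTheory GRing.Theory Num.Theory.
Local Open Scope ring_scope.

(** * Abstract simplicial complexes *)

Section AbstractComplexes.
Variable V : choiceType.
Local Open Scope fset_scope.
Implicit Types (K L : asc V) (v w : V) (s t : {fset V}).

(** The type [asc] carries no closure condition; this one makes a family an abstract simplicial
    complex with the empty face left out. *)
Definition face_closed K : Prop :=
  (fset0 \notin K) /\ forall s t, s \in K -> t `<=` s -> t != fset0 -> t \in K.

Lemma in_deletion K v s : (s \in deletion K v) = (s \in K) && (v \notin s).
Proof. by rewrite !inE. Qed.

Lemma in_link K v s :
  (s \in link K v) = [&& s \in K, v \notin s & v |` s \in K].
Proof. by rewrite !inE. Qed.

Lemma face_closed_deletion K v : face_closed K -> face_closed (deletion K v).
Proof.
move=> [K0 Kc]; split; first by rewrite in_deletion (negPf K0).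
move=> s t; rewrite !in_deletion => /andP[sK vs] ts t0.
by rewrite (Kc s) //=; apply: contra vs; apply: (fsubsetP ts).
Qed.

Lemma face_closed_link K v : face_closed K -> face_closed (link K v).
Proof.
move=> [K0 Kc]; split; first by rewrite in_link (negPf K0).
move=> s t; rewrite !in_link => /and3P[sK vs vsK] ts t0.
rewrite (Kc s) //=; apply/andP; split.
  by apply: contra vs; apply: (fsubsetP ts).
apply: (Kc _ _ vsK); first by apply: fsetUS.
by apply/fset0Pn; exists v; rewrite !inE eqxx.
Qed.

Lemma nonevasive_vertex K : nonevasive K -> exists v, is_vertex K v.
Proof.
by case=> [v|? v vK _ _ _]; exists v => //; rewrite /is_vertex inE.
Qed.

Lemma link_vertexP K v w :
  is_vertex (link K v) w -> [/\ is_vertex K w, w != v & [fset v; w] \in K].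
Proof.
rewrite /is_vertex in_link !inE => /and3P[wK vw vwK]; split=> //.
by rewrite eq_sym.
Qed.

(** A vertex of the nonevasive link spans an edge with [v], so [pos_dim] comes for free. *)
Lemma nonevasive_vertex_step K v : is_vertex K v ->
  nonevasive (link K v) -> nonevasive (deletion K v) -> nonevasive K.
Proof.
move=> vK nl nd; apply: (nonevasive_step vK _ nl nd).
have [w /link_vertexP[_ wv vwK]] := nonevasive_vertex nl.
by exists [fset v; w] => //; rewrite cardfs2 eq_sym wv.
Qed.

Lemma face_with_vertexP K v s : face_closed K -> s \in K -> v \in s ->
  s = [fset v] \/ exists2 t, t \in link K v & s = v |` t.
Proof.
move=> [K0 Kc] sK vs; have sE : s = v |` (s `\ v) by rewrite fsetD1K.
have [s0|s0] := eqVneq (s `\ v) fset0.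
  by left; rewrite sE s0 fsetU0.
right; exists (s `\ v) => //; rewrite in_link -sE sK andbT.
by rewrite (Kc s) ?fsubD1set // !inE eqxx.
Qed.

Lemma fsubset_add2l v s t : v \notin s -> (v |` s `<=` v |` t) = (s `<=` t).
Proof.
move=> vs; apply/idP/idP => [st|]; last exact: fsetUS.
apply/fsubsetP => x xs; have : x \in v |` t.
  by apply: (fsubsetP st); rewrite in_fset1U xs orbT.
by rewrite in_fset1U => /orP[/eqP xv|//]; rewrite -xv xs in vs.
Qed.

Lemma fproper_add2l v s t : v \notin s -> v \notin t ->
  (v |` s `<` v |` t) = (s `<` t).
Proof. by move=> vs vt; rewrite /fproper !fsubset_add2l. Qed.

Lemma fset_add_inj v s t : v \notin s -> v \notin t -> v |` s = v |` t -> s = t.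
Proof.
move=> vs vt e; have := congr1 (fun x => x `\ v) e.
by rewrite !fsetU1K.
Qed.

Lemma mem_cone v L r : (forall s, s \in L -> v \notin s) ->
  (r \in [fset v |` s | s in L]) = (v \in r) && (r `\ v \in L).
Proof.
move=> vL; apply/imfsetP/andP => [[/= s sL ->]|[vr rL]].
  by rewrite in_fset1U eqxx fsetU1K ?vL.
by exists (r `\ v) => //; rewrite fsetD1K.
Qed.

Lemma collapses_trans K1 K2 K3 :
  collapses K1 K2 -> collapses K2 K3 -> collapses K1 K3.
Proof.
move=> c; elim: c K3 => // {}K1 {}K2 K2' e _ IH K3 /IH.
exact: collapses_step.
Qed.

Lemma collapses_sub K K' : collapses K K' -> K' `<=` K.
Proof.
elim=> // {}K {}K' K'' [s [t [_ _ _ _ ->]]] _ /fsubset_trans; apply.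
exact: fsubsetDl.
Qed.

(* An elementary collapse (s, t) of L becomes the elementary collapse
   (v s, v t) of the cone over L with apex v. *)
Lemma collapses_cone D v L L' :
  (forall s, s \in D -> v \notin s) -> (forall s, s \in L -> v \notin s) ->
  collapses L L' ->
  collapses (D `|` ([fset v] |` [fset v |` s | s in L]))
            (D `|` ([fset v] |` [fset v |` s | s in L'])).
Proof.
move=> vD + c; elim: c => {L L'} [L _|L L1 L2]; first exact: collapses_refl.
move=> [s [t [sL tL [s0 st] free ->]]] _ IH vL.
have L1L a : a \in L `\` [fset s; t] -> a \in L by rewrite in_fsetD => /andP[].
have inC a : a \in L -> v |` a \in D `|` ([fset v] |` [fset v |` s | s in L]).
  by move=> aL; rewrite in_fsetU in_fset1U (in_imfset _ (fun x => v |` x)) ?orbT.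
apply: collapses_step (IH _); last by move=> a /L1L/vL.
exists (v |` s), (v |` t); split; [exact: inC|exact: inC|split| |].
- by apply/fset0Pn; exists v; rewrite in_fset1U eqxx.
- by rewrite fproper_add2l ?vL.
- move=> r + sr; have vr : v \in r.
    by apply: (fsubsetP (fproper_sub sr)); rewrite in_fset1U eqxx.
  rewrite in_fsetU in_fset1U => /or3P[/vD|/eqP rv|/imfsetP[/= a aL re]].
  + by rewrite vr.
  + move: sr; rewrite rv /fproper => /andP[_ /negP[]].
    by apply/fsubsetP => x /fset1P ->; rewrite in_fset1U eqxx.
  + rewrite re; congr (v |` _); apply: free => //.
    by move: sr; rewrite re fproper_add2l ?vL.
- apply/fsetP=> r; rewrite in_fsetD in_fset2 !in_fsetU !in_fset1.
  rewrite !mem_cone //; last by move=> a /L1L/vL.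
  have [vr|vr] /= := boolP (v \in r); last first.
    have ne a : (r == v |` a) = false.
      by apply: contraNF vr => /eqP ->; rewrite in_fset1U eqxx.
    by rewrite !ne.
  have eqv a : v \notin a -> (r == v |` a) = (r `\ v == a).
    move=> va; apply/eqP/eqP => [->|<-]; first by rewrite fsetU1K.
    by rewrite fsetD1K.
  have -> : (r \in D) = false by apply: contraTF vr => /vD.
  have -> : (r == [fset v]) = (r `\ v == fset0) by rewrite -eqv ?fsetU0.
  rewrite !eqv ?vL //= in_fsetD in_fset2.
  case: eqP => [->|//] /=; rewrite eq_sym (negPf s0) eq_sym.
  by have [t0|//] := eqVneq t fset0; move: st; rewrite t0 fproperEneq fsubset0 andbC; case: eqP.
Qed.

(** [K] is the deletion of [v] together with a cone over the link. Collapsing the link to a vertex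
    [w] collapses this cone to the edge [v w]; then [v] and this edge form a free pair, and after
    its removal the deletion collapses. *)
Lemma nonevasive_collapsible K : face_closed K -> nonevasive K -> collapsible K.
Proof.
move=> + ne; elim: ne => {K} [v _|K v vK _ _ IHl _ IHd cK].
  by exists v; apply: collapses_refl.
have [w cl] := IHl (face_closed_link v cK); have [u cd] := IHd (face_closed_deletion v cK).
exists u; apply: collapses_trans cd.
have vd s : s \in deletion K v -> v \notin s by rewrite in_deletion => /andP[].
have vl s : s \in link K v -> v \notin s by rewrite in_link => /and3P[].
have KE : K = deletion K v `|` ([fset v] |` [fset v |` s | s in link K v]).
  apply/fsetP => r; rewrite in_fsetU in_fset1U mem_cone // in_deletion.
  have [vr|vr] /= := boolP (v \in r); last first.
    have -> : (r == [fset v]) = false.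
      by apply: contraNF vr => /eqP ->; rewrite fset11.
    by rewrite !orbF andbT.
  rewrite andbF /=; apply/idP/orP => [rK|[/eqP->//|]].
    have [->|[t tl ->]] := face_with_vertexP cK rK vr; [by left|right].
    by rewrite fsetU1K ?vl.
  by rewrite in_link fsetD1K // => /and3P[].
have := collapses_cone vd vl cl; rewrite -KE => c1.
have /vl vw : [fset w] \in link K v.
  by apply: (fsubsetP (collapses_sub cl)); rewrite fset11.
have wv : v != w by rewrite in_fset1 in vw.
apply: collapses_trans c1 _; apply: collapses_step (collapses_refl _).
have mC r : r \in deletion K v `|` ([fset v] |` [fset v |` s | s in [fset [fset w]]]) =
    [|| r \in deletion K v, r == [fset v] | r == [fset v; w]].
  rewrite in_fsetU in_fset1U; congr [|| _, _ | _].
  by apply/imfsetP/eqP => [[/= s /fset1P -> ->//]|->]; exists [fset w]; rewrite ?fset11.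
exists [fset v], [fset v; w]; split; rewrite ?mC ?eqxx ?orbT //.
- split; first by apply/fset0Pn; exists v; rewrite fset11.
  rewrite fproperEcard cardfs1 cardfs2 wv andbT.
  by apply/fsubsetP => x /fset1P ->; rewrite in_fset2 eqxx.
- move=> r; rewrite mC => /or3P[/vd vr|/eqP->|/eqP->//].
    by move=> /fproper_sub/fsubsetP/(_ v); rewrite fset11 (negPf vr) => /(_ isT).
  by rewrite /fproper => /andP[_ /negP].
- apply/fsetP => r; rewrite in_fsetD in_fset2 mC.
  case: eqP => [->|_] /=; first by apply: contraTF (fset11 v) => /vd.
  case: eqP => [->|_] /=; last by rewrite orbF.
  apply: contraTF (fset21 v w) => /vd; exact.
Qed.
End AbstractComplexes.

(** * Order complexes and barycentric subdivision *)

Section OrderComplexes.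
Local Open Scope fset_scope.
Variables (I : choiceType) (le : I -> I -> Prop).
Hypothesis lexx : forall i, le i i.
Implicit Types (P Q : {fset I}) (i j k : I).

Lemma order_complexP P (c : {fset I}) :
  reflect [/\ c `<=` P, c != fset0 &
             forall i j, i \in c -> j \in c -> le i j \/ le j i]
          (c \in order_complex P le).
Proof.
apply: (iffP idP); first by rewrite !inE fpowersetE => /and3P[? ? /asboolP].
by case=> *; rewrite !inE fpowersetE; apply/and3P; split=> //; apply/asboolP.
Qed.

Lemma face_closed_order_complex P : face_closed (order_complex P le).
Proof.
split; first by apply/order_complexP => -[]; rewrite eqxx.
move=> s t /order_complexP[sP _ cs] ts t0; apply/order_complexP; split=> //.
  exact: fsubset_trans sP.
by move=> i j /(fsubsetP ts) ic /(fsubsetP ts); apply: cs.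
Qed.

Lemma is_vertex_order_complex P i : is_vertex (order_complex P le) i = (i \in P).
Proof.
apply/order_complexP/idP => [[]|iP]; first by rewrite fsub1set.
split; first by rewrite fsub1set.
  by apply/fset0Pn; exists i; rewrite fset11.
by move=> j k /fset1P -> /fset1P ->; left.
Qed.

Lemma deletion_order_complex P i :
  deletion (order_complex P le) i = order_complex (P `\ i) le.
Proof.
apply/fsetP => c; rewrite in_deletion.
apply/andP/order_complexP => [[/order_complexP[cP c0 cc] ic]|[cP c0 cc]].
  split=> //; apply/fsubsetP => j jc; rewrite in_fsetD1 (fsubsetP cP) // andbT.
  by apply: contraNneq ic => <-.
split; last by apply/negP => /(fsubsetP cP); rewrite in_fsetD1 eqxx.
by apply/order_complexP; split=> //; apply: fsubset_trans cP (fsubD1set _ _).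
Qed.

Definition comparables P i : {fset I} :=
  [fset j in P | (j != i) && `[< le j i \/ le i j >]].

Lemma comparablesP P i j :
  reflect [/\ j \in P, j != i & le j i \/ le i j] (j \in comparables P i).
Proof.
by rewrite !inE; apply: (iffP and3P) => -[jP ji /asboolP h]; split.
Qed.

Lemma link_order_complex P i : i \in P ->
  link (order_complex P le) i = order_complex (comparables P i) le.
Proof.
move=> iP; apply/fsetP => c; rewrite in_link.
apply/and3P/order_complexP => [[/order_complexP[cP c0 cc] ic]|[cP c0 cc]].
  move=> /order_complexP[_ _ cci]; split=> //; apply/fsubsetP => j jc.
  apply/comparablesP; split; first exact: (fsubsetP cP).
    by apply: contraNneq ic => <-.
  by apply: cci; rewrite in_fset1U ?eqxx // jc orbT.
have cPi j : j \in c -> [/\ j \in P, j != i & le j i \/ le i j].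
  by move=> jc; apply/comparablesP; apply: (fsubsetP cP).
have cP' : c `<=` P by apply/fsubsetP => j /cPi[].
split; first exact/order_complexP.
  by apply/negP => /cPi[_ /eqP].
apply/order_complexP; split.
- by rewrite fsubUset fsub1set iP.
- by apply/fset0Pn; exists i; rewrite in_fset1U eqxx.
- move=> j k; rewrite !in_fset1U => /orP[/eqP->|jc] /orP[/eqP->|kc].
  + by left.
  + by have [_ _ []] := cPi _ kc; [right|left].
  + by have [_ _ []] := cPi _ jc; [left|right].
  + exact: cc.
Qed.

Lemma nonevasive_order_step P i : i \in P ->
  nonevasive (order_complex (comparables P i) le) ->
  nonevasive (order_complex (P `\ i) le) -> nonevasive (order_complex P le).
Proof.
move=> iP nl nd; apply: (@nonevasive_vertex_step _ _ i).
- by rewrite is_vertex_order_complex.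
- by rewrite link_order_complex.
- by rewrite deletion_order_complex.
Qed.

(** For [i] other than [k], the apex [k] stays comparable to everything both in the link of [i] and
    in its deletion, so the other elements can be removed one by one. *)
Lemma nonevasive_order_cone P k : k \in P ->
  (forall j, j \in P -> le j k \/ le k j) -> nonevasive (order_complex P le).
Proof.
have [n] := ubnP #|` P|; elim: n => // n IH in P *; rewrite ltnS => sP kP kc.
have [P1|/eqP/eqP Pk0] := eqVneq (P `\ k) fset0.
  have {P1} -> : P = [fset k] by rewrite -(fsetD1K kP) P1 fsetU0.
  suff -> : order_complex [fset k] le = [fset [fset k]] by apply: nonevasive_point.
  apply/fsetP => c; rewrite in_fset1.
  apply/order_complexP/eqP => [[+ c0 _]|->].
    by rewrite fsubset1 (negPf c0) orbF => /eqP.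
  split=> //; first by apply/fset0Pn; exists k; rewrite fset11.
  by move=> i j /fset1P -> /fset1P ->; left.
have /fset0Pn[i] := Pk0; rewrite in_fsetD1 => /andP[ik iP].
have Pi : (#|` P `\ i| < n)%N by rewrite (leq_trans _ sP) // [X in (_ < X)%N](cardfsD1 i) iP.
apply: (nonevasive_order_step iP); apply: IH.
- apply: leq_ltn_trans Pi; apply: fsubset_leq_card; apply/fsubsetP => j.
  by rewrite in_fsetD1 => /comparablesP[-> -> _].
- by apply/comparablesP; split=> //; [rewrite eq_sym|case: (kc _ iP); [right|left]].
- by move=> j /comparablesP[/kc].
- exact: Pi.
- by rewrite in_fsetD1 kP eq_sym ik.
- by move=> j; rewrite in_fsetD1 => /andP[_ /kc].
Qed.

End OrderComplexes.

Section Barycentric.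
Local Open Scope fset_scope.

Lemma fset_argmin (T : choiceType) d (O : orderType d) (f : T -> O) (A : {fset T}) :
  A != fset0 -> exists2 a, a \in A & forall b, b \in A -> (f a <= f b)%O.
Proof.
case/fset0Pn => a0 a0A.
case: (@Order.TotalTheory.arg_minP _ _ A [` a0A] xpredT (fun i => f (val i)) isT).
move=> i _ h; exists (val i); first exact: valP.
by move=> b bA; apply: (h [` bA]).
Qed.

(* Stated for labelled copies of the face poset, so that the induction
   hypothesis applies to the faces containing v, a copy of the faces of the
   link of v. *)
Lemma nonevasive_face_poset (V : choiceType) (K : asc V) :
  nonevasive K -> face_closed K ->
  forall (I : choiceType) (le : I -> I -> Prop) (f : {fset V} -> I),
    (forall i, le i i) -> {in K &, injective f} ->
    {in K &, forall s t, le (f s) (f t) <-> s `<=` t} ->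
    nonevasive (order_complex (f @` K) le).
Proof.
elim=> {K} [v _|K v vK _ _ IHl _ IHd cK] I le f lexx fI fle.
  apply: (@nonevasive_order_cone _ _ lexx _ (f [fset v])).
    by apply: in_imfset; rewrite fset11.
  by move=> j /imfsetP[/= s /fset1P -> ->]; left.
have vl s : s \in link K v -> v \notin s by rewrite in_link => /and3P[].
have lK s : s \in link K v -> v |` s \in K by rewrite in_link => /and3P[].
have dK s : s \in deletion K v -> s \in K by rewrite in_deletion => /andP[].
have NEl : nonevasive (order_complex (comparables le (f @` K) (f [fset v])) le).
  suff -> : comparables le (f @` K) (f [fset v]) =
      (fun s => f (v |` s)) @` link K v.
    apply: (IHl (face_closed_link v cK)) => //.
      move=> s t sl tl /fI; rewrite !lK // => /(_ isT isT).
      by apply: fset_add_inj; apply: vl.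
    by move=> s t sl tl; rewrite fle ?lK // fsubset_add2l ?vl.
  apply/fsetP => i; apply/comparablesP/imfsetP.
    case=> /imfsetP[/= s sK ->] sv; rewrite !fle // => sub.
    have vs : v \in s.
      case: sub; last by rewrite fsub1set.
      rewrite fsubset1 => /orP[/eqP ->|/eqP s0]; first by rewrite fset11.
      by case: cK => /negP[]; rewrite -s0.
    have [s1|[t tl st]] := face_with_vertexP cK sK vs; last by exists t; rewrite -?st.
    by move: sv; rewrite s1 eqxx.
  case=> /= s sl ->; split; first by apply: in_imfset; apply: lK.
    apply/eqP => /(fI _ _ (lK _ sl) vK) e.
    have s0 : s = fset0.
      by apply: (@fset_add_inj _ v); [exact: vl|rewrite in_fset0|rewrite fsetU0].
    by have [/negP[]] := face_closed_link v cK; rewrite -s0.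
  by right; rewrite fle ?lK // fsubsetUl.
apply: (nonevasive_order_step lexx _ NEl); first exact: in_imfset.
(* With [[fset v]] gone, the faces of [Q] through [v] are removed, smallest first, until [Q] is the
   deletion of [v]. *)
suff main (Q : {fset {fset V}}) : deletion K v `<=` Q -> Q `<=` K ->
    [fset v] \notin Q -> nonevasive (order_complex (f @` Q) le).
  have -> : f @` K `\ f [fset v] = f @` (K `\ [fset v]).
    apply/fsetP => i; rewrite in_fsetD1; apply/andP/imfsetP.
      case=> iv /imfsetP[/= s sK ie]; exists s => //=.
      by rewrite in_fsetD1 sK andbT; apply: contraNneq iv => <-; rewrite ie.
    case=> /= s; rewrite in_fsetD1 => /andP[sv sK] ->; split; last exact: in_imfset.
    by apply: contraNneq sv => /fI ->.
  apply: main; rewrite ?fsubD1set ?in_fsetD1 ?eqxx //.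
  apply/fsubsetP => s; rewrite in_deletion in_fsetD1 => /andP[-> vs]; rewrite andbT.
  by apply: contraNneq vs => ->; rewrite fset11.
have [n] := ubnP #|` Q|; elim: n => // n IH in Q *; rewrite ltnS => sQ dQ QK vQ.
have [Q0|Q0] := eqVneq [fset s in Q | v \in s] fset0.
  have -> : Q = deletion K v.
    apply/eqP; rewrite eqEfsubset dQ andbT; apply/fsubsetP => s sQ'.
    rewrite in_deletion (fsubsetP QK) //=; apply/negP => vs.
    by have := in_fset0 s; rewrite -Q0 !inE /= sQ' vs.
  apply: (IHd (face_closed_deletion v cK)) => // [s t|s t] /dK sK /dK tK.
    exact: fI.
  exact: fle.
have [s] := fset_argmin (fun s : {fset V} => #|` s|) Q0.
rewrite !inE /= => /andP[sQ' vs] smin.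
have sK := fsubsetP QK _ sQ'.
have [s1|[t tl st]] := face_with_vertexP cK sK vs; first by rewrite -s1 sQ' in vQ.
have tQ : t \in Q.
  by apply: (fsubsetP dQ); rewrite in_deletion (vl _ tl) andbT; move: tl; rewrite in_link => /andP[].
have tK := fsubsetP QK _ tQ.
have vt := vl _ tl.
have ts : t != s by apply: contraNneq vt => ->.
have sPQ : f s \in f @` Q by apply: in_imfset.
have smin' q : q \in Q -> q `<` s -> v \notin q.
  move=> qQ /fproper_ltn_card qs; apply: contraTN qs => vq.
  by rewrite -leqNgt; apply: smin; rewrite !inE qQ.
have DE : f @` Q `\ f s = f @` (Q `\ s).
  apply/fsetP => i; rewrite in_fsetD1; apply/andP/imfsetP.
    case=> iv /imfsetP[/= q qQ ie]; exists q => //=.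
    by rewrite in_fsetD1 qQ andbT; apply: contraNneq iv => <-; rewrite ie.
  case=> /= q; rewrite in_fsetD1 => /andP[qs qQ] ->; split; last exact: in_imfset.
  by apply: contraNneq qs => /(fI _ _ (fsubsetP QK _ qQ) sK) ->.
(* By minimality of [s], the faces of [Q] properly inside [s] avoid [v] and so lie in [t], while
   faces containing [s] contain [t]: the link of [s] is a cone with apex [t]. *)
apply: (nonevasive_order_step lexx sPQ).
  apply: (@nonevasive_order_cone _ _ lexx _ (f t)).
    apply/comparablesP; split; first exact: in_imfset.
      by apply: contraNneq ts => /(fI _ _ tK sK) ->.
    by left; rewrite fle // st fsubsetUr.
  move=> _ /comparablesP[/imfsetP[/= q qQ ->] qs].
  have qK := fsubsetP QK _ qQ.
  rewrite !fle // => -[qs'|sq]; last first.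
    by right; apply: fsubset_trans sq; rewrite st fsubsetUr.
  left; have vq : v \notin q.
    apply: smin' => //; rewrite fproperEneq qs' andbT.
    by apply: contraNneq qs => ->.
  by rewrite -(fsubset_add2l _ vq) -st; apply/fsubsetP => x;
    rewrite in_fset1U => /orP[/eqP->//|/(fsubsetP qs')].
rewrite DE; apply: IH.
- by rewrite (leq_trans _ sQ) // [X in (_ < X)%N](cardfsD1 s) sQ'.
- apply/fsubsetP => q qd; rewrite in_fsetD1 (fsubsetP dQ) // andbT.
  by apply: contraTneq qd => ->; rewrite in_deletion vs andbF.
- by apply: fsubset_trans QK; apply: fsubD1set.
- by rewrite in_fsetD1 (negPf vQ) andbF.
Qed.

Lemma nonevasive_sd (V : choiceType) (K : asc V) :
  face_closed K -> nonevasive K -> nonevasive (sd K).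
Proof.
move=> cK nK; have -> : sd K = order_complex (id @` K) (fun s t => s `<=` t).
  by congr order_complex; apply/fsetP => s; rewrite imfset_id.
exact: (nonevasive_face_poset nK).
Qed.

Lemma sd_holds_nonevasive r (V : choiceType) (K : asc V) :
  face_closed K -> nonevasive K ->
  sd_holds nonevasive_and_collapsible r K.
Proof.
elim: r V K => [|r IH] V K cK nK /=.
  by split=> //; apply: nonevasive_collapsible.
by apply: IH; [apply: face_closed_order_complex|apply: nonevasive_sd].
Qed.

End Barycentric.

(** * Peeling an order complex along a height function *)

Section Peeling.
Local Open Scope fset_scope.
Variables (I : choiceType) (le : I -> I -> Prop) (R : realType).
Hypothesis lexx : forall i, le i i.

(* The classes of equal c are removed by decreasing m; inside a class, the
   elements i <> c i go first because their link is a cone with apex c i. *)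
Lemma nonevasive_peel (P : {fset I}) (m : I -> R) (c : I -> I) (k0 : I) :
  {in P & P & P, forall i j k, le i j -> le j k -> le i k} ->
  {in P, forall i, [/\ c i \in P, le (c i) i, m (c i) = m i & c (c i) = c i]} ->
  {in P &, forall i j, le i j -> m j <= m i} ->
  {in P &, forall i j, le i j -> m i = m j -> c i = c j} ->
  k0 \in P -> {in P, forall i, m k0 <= m i} ->
  {in P, forall i, m i = m k0 -> c i = c k0} ->
  (forall k, k \in P -> c k = k -> m k0 < m k -> nonevasive
     (order_complex [fset i in P | `[< le k i >] && (m i < m k)] le)) ->
  nonevasive (order_complex P le).
Proof.
move=> ltr cP mle ceq k0P k0m k0c up.
(* Invariant of the sets [Q] met on the way: everything strictly lower than a remaining element is
   still there, and [c i] outlasts [i]. *)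
suff main (Q : {fset I}) : Q `<=` P -> k0 \in Q ->
    (forall i j, i \in Q -> j \in P -> m j < m i -> j \in Q) ->
    (forall i, i \in Q -> c i \in Q) -> nonevasive (order_complex Q le).
  by apply: main => // i iP; case: (cP _ iP).
have [n] := ubnP #|` Q|; elim: n => // n IH in Q *; rewrite ltnS => sQ QP k0Q mQ cQ.
have inP i : i \in Q -> i \in P by apply: (fsubsetP QP).
have Q0 : Q != fset0 by apply/fset0Pn; exists k0.
have [i1 i1Q i1max] := fset_argmin (fun i => - m i) Q0.
have imax i : i \in Q -> m i <= m i1 by move=> /i1max; rewrite lerN2.
(* Once all remaining heights are minimal, [c k0] lies below every element and the complex is a
   cone. *)
have [i1min|i1min] := eqVneq (m i1) (m k0).
  apply: (nonevasive_order_cone lexx (cQ _ k0Q)) => j jQ; right.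
  have mj : m j = m k0.
    by apply/eqP; rewrite eq_le -{1}i1min imax ?k0m ?inP.
  by rewrite -(k0c j) ?inP //; case: (cP j) => //; apply: inP.
have k0i1 : m k0 < m i1 by rewrite lt_neqAle eq_sym i1min k0m ?inP.
have step i : i \in Q -> m i = m i1 -> (forall j, j \in Q -> c j = i -> j = i) ->
    nonevasive (order_complex (comparables le Q i) le) ->
    nonevasive (order_complex Q le).
  move=> iQ mi ci nl; apply: (nonevasive_order_step lexx iQ nl); apply: IH.
  - by rewrite (leq_trans _ sQ) // [X in (_ < X)%N](cardfsD1 i) iQ.
  - by apply: fsubset_trans QP; apply: fsubD1set.
  - rewrite in_fsetD1 k0Q andbT; apply: contraTneq k0i1 => ->.
    by rewrite mi ltxx.
  - move=> j k; rewrite !in_fsetD1 => /andP[_ jQ] kP kj; rewrite (mQ _ _ jQ kP kj) andbT.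
    by apply: contraTneq kj => ->; rewrite mi -leNgt imax.
  - move=> j; rewrite !in_fsetD1 => /andP[ji jQ]; rewrite cQ // andbT.
    by apply: contra_neq ji => /ci ->.
have [/existsP|] := boolP [exists i : Q, (m (val i) == m i1) && (c (val i) != val i)].
  case=> -[i iQ] /= /andP[/eqP mi ci].
  have [cPi cle mc cc] := cP _ (inP _ iQ).
  apply: (step _ iQ mi) => [j jQ ji|].
    by move: ci; rewrite -ji; have [_ _ _ ->] := cP _ (inP _ jQ); rewrite eqxx.
  apply: (@nonevasive_order_cone _ _ lexx _ (c i)).
    by apply/comparablesP; split; [apply: cQ| |left].
  move=> j /comparablesP[jQ ji [lji|lij]]; right; last first.
    by apply: ltr cle lij => //; apply: inP.
  (* An element below [i] has at least its height, hence the maximal one; then [c j = c i] lies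
     below [j]. *)
  have mj : m j = m i.
    by apply/eqP; rewrite eq_le {1}mi imax //= mle // inP.
  rewrite -(ceq j i) ?inP //.
  by have [] := cP _ (inP _ jQ).
rewrite negb_exists => /forallP crit.
have ci i : i \in Q -> m i = m i1 -> c i = i.
  by move=> iQ mi; have := crit [` iQ]; rewrite /= mi eqxx /= negbK => /eqP.
have ci1 := ci _ i1Q erefl.
apply: (step _ i1Q erefl) => [j jQ cj|].
  rewrite -cj ci //; rewrite -cj.
  by have [_ _ -> _] := cP _ (inP _ jQ).
(* Two comparable elements of top height have equal [c], hence coincide; so whatever else is
   comparable to [i1] has smaller height, and then it lies above [i1] for [le]. *)
suff -> : comparables le Q i1 = [fset i in P | `[< le i1 i >] && (m i < m i1)].
  by apply: up => //; apply: inP.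
apply/fsetP => j; apply/idP/idP => [/comparablesP[jQ ji ij]|].
  have jP := inP _ jQ; have i1P := inP _ i1Q.
  have mj : m j < m i1.
    rewrite lt_neqAle imax // andbT; apply: contraNneq ji => mj.
    rewrite -(ci _ jQ mj) -ci1; case: ij => ij; first by rewrite (ceq j i1).
    by rewrite -(ceq i1 j).
  rewrite !inE /= jP mj andbT /=; apply/asboolP; case: ij => // /(mle _ _ jP i1P).
  by rewrite leNgt mj.
move=> jU; apply/comparablesP; move: jU; rewrite !inE /= => /and3P[jP /asboolP lij mj].
split; [exact: mQ mj| |by right].
by apply: contraTneq mj => ->; rewrite ltxx.
Qed.
End Peeling.

(** * Polyhedra *)

Section Dotp.
Variables (R : realType) (d : nat).
Local Notation pt := 'rV[R]_d.
Implicit Types (x y z p q : pt) (a b t : R).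

Lemma dotpC x y : dotp x y = dotp y x.
Proof. by apply: eq_bigr => i _; rewrite mulrC. Qed.

Lemma dotpDr x y z : dotp x (y + z) = dotp x y + dotp x z.
Proof. by rewrite -big_split; apply: eq_bigr => i _; rewrite mxE mulrDr. Qed.

Lemma dotpZr a x y : dotp x (a *: y) = a * dotp x y.
Proof. by rewrite /dotp mulr_sumr; apply: eq_bigr => i _; rewrite mxE mulrCA. Qed.

Lemma dotp0r x : dotp x 0 = 0.
Proof. by rewrite -(scale0r 0) dotpZr mul0r. Qed.

Lemma dotpNr x y : dotp x (- y) = - dotp x y.
Proof. by rewrite -scaleN1r dotpZr mulN1r. Qed.

Lemma dotpBr x y z : dotp x (y - z) = dotp x y - dotp x z.
Proof. by rewrite dotpDr dotpNr. Qed.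

Lemma dotpDl x y z : dotp (x + y) z = dotp x z + dotp y z.
Proof. by rewrite !(dotpC _ z) dotpDr. Qed.

Lemma dotpZl a x y : dotp (a *: x) y = a * dotp x y.
Proof. by rewrite !(dotpC _ y) dotpZr. Qed.

Lemma dotpNl x y : dotp (- x) y = - dotp x y.
Proof. by rewrite !(dotpC _ y) dotpNr. Qed.

Lemma dotp_sumr (I : Type) (r : seq I) (P : pred I) (F : I -> pt) x :
  dotp x (\sum_(i <- r | P i) F i) = \sum_(i <- r | P i) dotp x (F i).
Proof. exact: (big_morph (dotp x) (dotpDr x) (dotp0r x)). Qed.

Definition dotpE := (dotpDl, dotpDr, dotpZl, dotpZr, dotpNl, dotpNr).

Lemma dotp_ge0 x : 0 <= dotp x x.
Proof. by apply: sumr_ge0 => i _; rewrite -expr2 sqr_ge0. Qed.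

Lemma dotp_eq0 x : (dotp x x == 0) = (x == 0).
Proof.
apply/eqP/eqP => [e|->]; last exact: dotp0r.
apply/rowP => i; rewrite mxE; apply/eqP; rewrite -sqrf_eq0 expr2.
have /psumr_eq0P/(_ e)/(_ i isT) -> // : forall i, true -> 0 <= x 0 i * x 0 i.
by move=> j _; rewrite -expr2 sqr_ge0.
Qed.

Lemma coord_sqr_le_dotp x i : x 0 i ^+ 2 <= dotp x x.
Proof.
rewrite /dotp (bigD1 i) //= expr2 lerDl sumr_ge0 // => j _.
by rewrite -expr2 sqr_ge0.
Qed.

End Dotp.

Section Polyhedra.
Import topology normedtype derive numFieldNormedType.Exports.
Local Open Scope classical_set_scope.
Variables (R : realType) (d : nat).
Local Notation pt := 'rV[R]_d.
Implicit Types (x y z p q : pt) (a b t e : R) (F G : set pt) (L : seq (pt * R)).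

Definition halfspaces L : set pt := fun x => forall k, k \in L -> dotp k.1 x <= k.2.

Definition polyhedral F : Prop := exists L, F = halfspaces L.

Definition convex F : Prop :=
  forall x y t, F x -> F y -> 0 <= t <= 1 -> F ((1 - t) *: x + t *: y).

Lemma polyhedral_convex F : polyhedral F -> convex F.
Proof.
case=> L -> x y t Fx Fy /andP[t0 t1] k kL; rewrite !dotpE.
have := Fx k kL; have := Fy k kL; nra.
Qed.

Lemma continuous_sum (f : 'I_d -> pt -> R) :
  (forall i, continuous (f i)) -> continuous (fun x => \sum_i f i x).
Proof.
move=> cf.
have addc : continuous (fun z : R * R => z.1 + z.2).
  by move=> z; apply: cvgD; [apply: cvg_fst|apply: cvg_snd].
by apply: (continuous_big addc) => i _; apply: cf.
Qed.

Lemma continuous_dotp x : continuous (dotp x : pt -> R).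
Proof.
apply: continuous_sum => i y.
by apply: (@cvgM _ _ (nbhs y)); [apply: cvg_cst|apply: coord_continuous].
Qed.

Lemma halfspaces_closed L : closed (halfspaces L).
Proof.
elim: L => [|k L IH].
  suff -> : halfspaces [::] = setT by apply: closedT.
  by apply/seteqP; split.
have -> : halfspaces (k :: L) =
    setI (preimage (dotp k.1) [set r | r <= k.2]) (halfspaces L).
  apply/seteqP; split=> [x Fx|x [/= kx Fx] j].
    split=> [|j jL]; first by apply: Fx; rewrite mem_head.
    by apply: Fx; rewrite inE jL orbT.
  by rewrite inE => /orP[/eqP->|/Fx].
apply: closedI IH; apply: preimage_closed; last exact: closed_le.
by move=> y _; apply: continuous_dotp.
Qed.

Lemma itv_of_sqr (u v M : R) :
  1 <= M -> (u - v) ^+ 2 <= M - 1 -> `[v - M, v + M] u.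
Proof.
move=> M1 h; have [h1 h2] : - M <= u - v /\ u - v <= M by split; nra.
by rewrite /= in_itv /=; apply/andP; split; lra.
Qed.

(** The points at least as close to [x] as [p0] lie in a compact box, where the extreme value
    theorem applies; all others are farther than [p0]. *)
Lemma nearest_point F x : polyhedral F -> F !=set0 ->
  exists2 p, F p & forall q, F q -> dotp (p - x) (p - x) <= dotp (q - x) (q - x).
Proof.
(* The summand 1 lets a square bounded by [M - 1] bound its root by [M], without square roots. *)
case=> L FL [p0 Fp0]; pose M := dotp (p0 - x) (p0 - x) + 1.
have M1 : 1 <= M by rewrite lerDr dotp_ge0.
pose box : set pt := [set v | forall i, `[x 0 i - M, x 0 i + M] (v ord0 i)].
have cbox : compact box.
  apply: (@rV_compact _ _ (fun i => `[x 0 i - M, x 0 i + M])) => i /=.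
  exact: segment_compact.
have inbox q : dotp (q - x) (q - x) <= dotp (p0 - x) (p0 - x) -> box q.
  move=> le i /=.
  apply: itv_of_sqr => //; have := coord_sqr_le_dotp (q - x) i.
  rewrite !mxE /M addrK => h; exact: le_trans h le.
have cA : compact (setI box F).
  apply: compact_closedI; first exact: cbox.
  by rewrite FL; apply: halfspaces_closed.
have A0 : setI box F !=set0 by exists p0; split=> //; apply: inbox.
have cf : {within setI box F, continuous (fun q => dotp (q - x) (q - x))}.
  apply: continuous_subspaceT; apply: continuous_sum => i; move=> y.
  have cc : (q - x) 0 i @[q --> y] --> (y - x) 0 i.
    rewrite !mxE; under eq_fun do rewrite !mxE.
    by apply: (@cvgB _ _ _ (nbhs y)); [exact: coord_continuous|exact: cvg_cst].
  exact: (@cvgM _ _ (nbhs y)).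
have [p] := EVT_min_rV A0 cA cf; rewrite inE => -[_ Fp] pmin.
exists p => // q Fq.
have [le|lt] := leP (dotp (q - x) (q - x)) (dotp (p0 - x) (p0 - x)).
  by apply: pmin; rewrite inE; split=> //; apply: inbox.
apply: le_trans (ltW lt); apply: pmin; rewrite inE; split=> //.
exact: inbox.
Qed.
End Polyhedra.

(** * Local behaviour of polyhedra and slices of tangent cones *)

Section Slices.
Variables (R : realType) (d : nat).
Local Notation pt := 'rV[R]_d.
Implicit Types (x y z p q n : pt) (a b t e : R) (F G : set pt) (L : seq (pt * R)).

(** Parallelogram law: were [p] and [q] distinct, their midpoint would be nearer to [x]. *)
Lemma nearest_unique F x p q : convex F -> F p -> F q ->
  (forall z, F z -> dotp (p - x) (p - x) <= dotp (z - x) (z - x)) ->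
  dotp (q - x) (q - x) = dotp (p - x) (p - x) -> p = q.
Proof.
move=> cF Fp Fq pmin qp; apply/eqP; rewrite -subr_eq0 -dotp_eq0.
rewrite eq_le dotp_ge0 andbT.
have half01 : 0 <= (1 / 2 : R) <= 1 by apply/andP; split; lra.
have := pmin _ (cF _ _ _ Fp Fq half01).
have -> : (1 - 1 / 2) *: p + (1 / 2) *: q - x = (1 / 2) *: ((p - x) + (q - x)).
  by apply/rowP => i; rewrite !mxE; field.
have -> : p - q = (p - x) - (q - x) by apply/rowP => i; rewrite !mxE; ring.
move: (p - x) (q - x) qp => u v qp; rewrite !dotpE (dotpC v u).
move: (dotp u u) (dotp v v) (dotp u v) qp => r s w ->; lra.
Qed.

Lemma small_multiple (D g : R) : exists2 e : R, 0 < e &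
  forall e', 0 < e' -> e' <= e -> (0 < D -> e' * g < D) /\ (D < 0 -> D < e' * g).
Proof.
have [->|D0] := eqVneq D 0; first by exists 1 => // e'; rewrite ltxx.
have g0 : 0 < `|g| + 1 by rewrite ltr_wpDl.
exists (`|D| / (`|g| + 1)) => [|e' e'0]; first by rewrite divr_gt0 ?normr_gt0.
rewrite ler_pdivlMr // => h.
have : `|e' * g| < `|D|.
  by rewrite normrM (gtr0_norm e'0); apply: lt_le_trans h; rewrite ltr_pM2l // ltrDl.
rewrite ltr_norml => /andP[h1 h2]; split=> Ds.
  by rewrite (gtr0_norm Ds) in h2.
by rewrite (ltr0_norm Ds) opprK in h1.
Qed.

Lemma ray_halfspaces L p y : exists2 e : R, 0 < e & forall e', 0 < e' -> e' <= e ->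
  forall k, k \in L -> (dotp k.1 p < k.2 -> dotp k.1 (p + e' *: y) < k.2) /\
                       (k.2 < dotp k.1 p -> k.2 < dotp k.1 (p + e' *: y)).
Proof.
elim: L => [|k L [e e0 IH]]; first by exists 1.
have [e1 e1_gt0 h1] := small_multiple (k.2 - dotp k.1 p) (dotp k.1 y).
exists (Num.min e e1) => [|e' e'0]; first by rewrite lt_min e0.
rewrite le_min => /andP[e'e e'e1] j; rewrite inE => /orP[/eqP ->{j}|]; last exact: IH.
have [ha hb] := h1 _ e'0 e'e1; rewrite dotpDr dotpZr.
by split=> h; [have := ha; rewrite subr_gt0|have := hb; rewrite subr_lt0];
  move=> /(_ h); [rewrite ltrBrDl|rewrite ltrBlDl].
Qed.

(** Along a short ray from [p], violated inequalities stay violated and slack ones slack; a tight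
    one depends only on the sign of its normal against [y], not on how far along the ray it is
    tested. *)
Lemma ray_polyhedral F p y : polyhedral F -> exists2 e : R, 0 < e &
  forall e', 0 < e' -> e' <= e ->
    (F (p + e' *: y) -> F p) /\
    (F p -> forall b, 0 < b -> F (p + b *: y) -> F (p + e' *: y)).
Proof.
case=> L ->; have [e e0 he] := ray_halfspaces L p y; exists e => // e' e'0 e'e.
split=> [h k kL|Fp b b0 h k kL].
  have [_ hk] := he _ e'0 e'e _ kL; rewrite leNgt; apply/negP => /hk.
  by rewrite ltNge h.
have [hk _] := he _ e'0 e'e _ kL.
have [/hk/ltW//|] := ltP (dotp k.1 p) k.2 => pk.
have /eqP kp : dotp k.1 p == k.2 by rewrite eq_le pk Fp.
have := h _ kL; rewrite !dotpDr !dotpZr kp !gerDl !pmulr_rle0 //.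
Qed.

Lemma ray_polyhedral_family (I : choiceType) (P : seq I) (F : I -> set pt) p y :
  (forall i, i \in P -> polyhedral (F i)) -> exists2 e : R, 0 < e &
  forall e', 0 < e' -> e' <= e -> forall i, i \in P ->
    (F i (p + e' *: y) -> F i p) /\
    (F i p -> forall b, 0 < b -> F i (p + b *: y) -> F i (p + e' *: y)).
Proof.
elim: P => [|i P IH] pF; first by exists 1.
have [|e e0 he] := IH; first by move=> j jP; apply: pF; rewrite inE jP orbT.
have [e1 e10 he1] := ray_polyhedral p y (pF _ (mem_head _ _)).
exists (Num.min e e1) => [|e' e'0]; first by rewrite lt_min e0.
rewrite le_min => /andP[e'e e'e1] j; rewrite inE => /orP[/eqP ->{j}|]; last exact: he.
exact: he1.
Qed.

(* The slice at height <n, y> = 1 of the tangent cone of F at p. *)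
Definition slice F p n : set pt :=
  fun y => dotp n y = 1 /\ exists2 e : R, 0 < e & F (p + e *: y).

(** The tangent cone is cut out by the inequalities tight at [p], made homogeneous; the slack ones
    hold automatically close to [p]. *)
Lemma polyhedral_slice F p n : polyhedral F -> F p -> polyhedral (slice F p n).
Proof.
case=> L FL Fp; rewrite FL in Fp *.
pose T := [seq (k.1, 0 : R) | k <- L & dotp k.1 p == k.2].
exists ((n, 1) :: (- n, - 1) :: T).
apply/seteqP; split=> y.
  case=> ny [e e0 Fy] k; rewrite !inE => /or3P[/eqP->|/eqP->|/mapP[j]] /=.
  - by rewrite ny.
  - by rewrite dotpNl ny.
  - rewrite mem_filter => /andP[/eqP jp jL] -> /=.
    have := Fy _ jL; rewrite dotpDr dotpZr jp gerDl pmulr_rle0 //.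
move=> hy; split.
  apply/eqP; rewrite eq_le (hy (n, 1)) ?mem_head //=.
  by have := hy (- n, - 1); rewrite dotpNl lerN2 /=; apply; rewrite !inE eqxx orbT.
have [e e0 he] := ray_halfspaces L p y; exists e => // k kL.
have [hk _] := he _ e0 (lexx e) _ kL.
have [/hk/ltW//|] := ltP (dotp k.1 p) k.2 => pk.
have kp : dotp k.1 p == k.2 by rewrite eq_le pk Fp.
have := hy (k.1, 0); rewrite !inE => /= h.
rewrite dotpDr dotpZr (eqP kp) gerDl pmulr_rle0 //; apply: h.
by apply/or3P/Or33/mapP; exists k; rewrite // mem_filter kp.
Qed.

End Slices.

(** * Star-shaped polyhedral complexes *)

Section StarShaped.
Variables (R : realType) (d : nat) (I : choiceType) (le : I -> I -> Prop).
Local Notation pt := 'rV[R]_d.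
Hypothesis le_refl : forall i, le i i.
Hypothesis le_tr : forall i j k, le i j -> le j k -> le i k.
Implicit Types (x y z p q n : pt) (a b t e : R) (P : {fset I}) (F : I -> set pt).

Definition cell_union P F : set pt := fun y => exists2 i, i \in P & F i y.

Definition star_center (X : set pt) x : Prop :=
  X x /\ forall y, X y -> forall t, 0 <= t <= 1 -> X ((1 - t) *: x + t *: y).

(* Every point lies in a least cell: all that is used of the axioms of a
   polyhedral complex.  Unlike these, it visibly passes to slices. *)
Definition carried P F : Prop := forall y, cell_union P F y ->
  exists2 k, k \in P & forall j, j \in P -> (F j y <-> le k j).

Lemma convex_ray (G : set pt) p y e b : convex G -> G p -> 0 < e ->
  G (p + e *: y) -> 0 <= b -> b <= e -> G (p + b *: y).
Proof.
move=> cG Gp e0 Ge b0 be.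
have -> : p + b *: y = (1 - b / e) *: p + (b / e) *: (p + e *: y).
  by apply/rowP => i; rewrite !mxE; field; rewrite gt_eqF.
by apply: cG => //; rewrite divr_ge0 ?ler_pdivrMr ?mul1r // ltW.
Qed.

(** For small [a] the point lies on the segment from the center [p + n] to some [p + b *: y] with
    [b] small; the latter is in [F i] by convexity, so star-shapedness applies. *)
Lemma cell_union_toward_center P F p n i y e t :
  (forall i, i \in P -> convex (F i)) -> star_center (cell_union P F) (p + n) ->
  i \in P -> F i p -> 0 < e -> F i (p + e *: y) -> 0 <= t <= 1 -> 0 < dotp n n ->
  exists2 e0 : R, 0 < e0 & forall a, 0 < a -> a <= e0 ->
    cell_union P F (p + a *: ((1 - t) *: ((dotp n n)^-1 *: n) + t *: y)).
Proof.
move=> cF [_ star] iP Fp e0 Fe /andP[t0 t1].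
move: (dotp n n) => N N0.
(* [a <= N / 2] gives [s >= 1 / 2], and then [a <= e / 2] gives [a * t / s <= e]. *)
exists (Num.min (N / 2) (e / 2)) => [|a a0]; first by rewrite lt_min !divr_gt0.
rewrite le_min => /andP[aN ae].
pose s := 1 - a * (1 - t) / N.
have sE : s * N = N - a * (1 - t) by rewrite /s; field; rewrite gt_eqF.
have s12 : 1 / 2 <= s by rewrite -(ler_pM2r N0) sE; nra.
have s1 : s <= 1 by rewrite -(ler_pM2r N0) sE; nra.
have s0 : 0 < s by apply: lt_le_trans s12; lra.
have -> : p + a *: ((1 - t) *: (N^-1 *: n) + t *: y) =
    (1 - s) *: (p + n) + s *: (p + (a * t / s) *: y).
  apply/rowP => j; rewrite !mxE.
  have -> : s * (p 0 j + a * t / s * y 0 j) = s * p 0 j + a * t * y 0 j.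
    by field; rewrite gt_eqF.
  by rewrite /s; field; rewrite gt_eqF.
apply: star; last by rewrite s1 ltW.
exists i => //; apply: (convex_ray (cF _ iP) Fp e0 Fe).
  by rewrite divr_ge0 ?mulr_ge0 // ltW.
rewrite ler_pdivrMr //; nra.
Qed.

(** Induction on the number of cells. Labels ordered by a fixed [le] let each slice keep the index
    of its cell, and slices stay in the same ambient space. *)
Theorem star_nonevasive P F x :
  (forall i, i \in P -> polyhedral (F i)) ->
  (forall i, i \in P -> F i !=set0)%classic ->
  carried P F -> star_center (cell_union P F) x -> nonevasive (order_complex P le).
Proof.
have [N] := ubnP #|` P|; elim: N => // N IH in P F x *; rewrite ltnS => PN.
move=> polF F0 car [[ix ixP Fx] star].
have cvxF i : i \in P -> convex (F i) by move=> /polF/polyhedral_convex.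
have /choice[p pP] : forall i, exists p, i \in P -> F i p /\
    forall q, F i q -> dotp (p - x) (p - x) <= dotp (q - x) (q - x).
  move=> i; have [iP|] := boolP (i \in P); last by exists 0.
  by have [q Fq qmin] := nearest_point x (polF _ iP) (F0 _ iP); exists q.
have /choice[car_ carP] : forall y, exists k, cell_union P F y ->
    k \in P /\ forall j, j \in P -> (F j y <-> le k j).
  move=> y; have [/car[k kP h]|] := pselect (cell_union P F y); first by exists k.
  by exists ix.
pose m i := dotp (p i - x) (p i - x); pose c i := car_ (p i).
have le_sub i j y : i \in P -> j \in P -> le i j -> F i y -> F j y.
  move=> iP jP ij Fy; have [kP h] := carP y (ex_intro2 _ _ i iP Fy).
  by apply/(h _ jP)/(le_tr _ ij)/(h _ iP).
have Fp i : i \in P -> F i (p i) by move=> /pP[].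
have cP i : i \in P -> c i \in P /\ forall j, j \in P -> (F j (p i) <-> le (c i) j).
  by move=> iP; apply: carP; exists i => //; apply: Fp.
have m_le i j : i \in P -> j \in P -> le i j -> m j <= m i.
  by move=> iP jP ij; have [_] := pP _ jP; apply; apply: le_sub (Fp _ iP).
have p_eq i j : i \in P -> j \in P -> F j (p i) -> m i = m j -> p i = p j.
  move=> iP jP Fj mij; apply/esym/(nearest_unique (cvxF _ jP) (Fp _ jP) Fj _ mij).
  by have [] := pP _ jP.
have px : p ix = x.
  apply/eqP; rewrite -subr_eq0 -dotp_eq0 eq_le dotp_ge0 andbT.
  by have [_ /(_ _ Fx)] := pP _ ixP; rewrite subrr dotp0r.
have mix : m ix = 0 by rewrite /m px subrr dotp0r.
apply: (@nonevasive_peel _ le R le_refl P m c ix) => //.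
- by move=> i j k _ _ _; apply: le_tr.
- move=> i iP; have [ciP h] := cP _ iP.
  have li : le (c i) i by apply/h => //; apply: Fp.
  have Fci : F (c i) (p i) by apply/h.
  have mci : m (c i) = m i.
    apply/eqP; rewrite eq_le (m_le _ _ ciP iP li) andbT.
    by have [_] := pP _ ciP; apply.
  by split=> //; rewrite /c -(p_eq i (c i)).
- move=> i j iP jP ij mij; rewrite /c (p_eq i j) //.
  exact: le_sub (Fp _ iP).
- by move=> i iP; rewrite mix dotp_ge0.
- move=> i iP; rewrite mix => /eqP; rewrite dotp_eq0 subr_eq0 => /eqP.
  by rewrite /c px => ->.
move=> k kP ck; rewrite mix => mk0.
have [_ carpk] := cP _ kP; rewrite ck in carpk.
set P' := [fset i in P | _]%fset.
pose q := p k; have [n xE] : exists n, x = q + n by exists (x - q); rewrite addrC subrK.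
have P'P i : reflect [/\ i \in P, le k i & m i < m k] (i \in P').
  by rewrite !inE; apply: (iffP and3P) => -[? /asboolP ? ?]; split.
have nE y : y - x = (y - q) - n by rewrite xE opprD addrA.
have mkE : m k = dotp n n by rewrite /m -/q nE subrr sub0r dotpNl dotpNr opprK.
have N0 : 0 < dotp n n by rewrite -mkE.
(* Moving from [q] by [b *: z] changes the squared distance to [x] by [b ^+ 2 * dotp z z - 2 * b],
   negative for small [b]: the cell [j] reaches nearer to [x] than [k] does. *)
have inP' j z e : j \in P -> F j q -> 0 < e -> F j (q + e *: z) -> dotp n z = 1 -> j \in P'.
  move=> jP Fjq e0 Fjz nz; apply/P'P; split=> //; first exact/carpk.
  pose b := Num.min e (dotp z z + 1)^-1.
  have z0 := dotp_ge0 z.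
  have z1 : 0 < dotp z z + 1 by rewrite ltr_wpDl.
  have b0 : 0 < b by rewrite lt_min e0 invr_gt0.
  have be : b <= e by rewrite ge_min lexx.
  have bz : b * (dotp z z + 1) <= 1.
    by rewrite -ler_pdivlMr // mul1r ge_min lexx orbT.
  have [_ /(_ _ (convex_ray (cvxF _ jP) Fjq e0 Fjz (ltW b0) be))] := pP _ jP.
  move=> /le_lt_trans; apply; rewrite mkE.
  have -> : q + b *: z - x = b *: z - n by rewrite nE [q + _]addrC addrK.
  rewrite !dotpE (dotpC z n) nz; move: (dotp z z) (dotp n n) z0 b0 bz => r s r0 b0 bz.
  nra.
(* A cell containing a point of the ray close enough to [q] contains [q] too, so points of the union
   near [q] in direction [z] come from cells whose slice contains [z]. *)
have supp' z : dotp n z = 1 ->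
    (exists2 e0 : R, 0 < e0 & forall a, 0 < a -> a <= e0 -> cell_union P F (q + a *: z)) ->
    cell_union P' (fun i => slice (F i) q n) z.
  move=> nz [e0 e00 h].
  have [e e_gt0 he] := ray_polyhedral_family q z polF.
  pose a := Num.min e e0.
  have a0 : 0 < a by rewrite lt_min e_gt0.
  have [|j jP Fj] := h a a0; first by rewrite ge_min lexx orbT.
  have [|Fjq _] := he a a0 _ _ jP; first by rewrite ge_min lexx.
  exists j; first exact: (inP' j z a jP (Fjq Fj) a0 Fj nz).
  by split=> //; exists a.
have Fq i : i \in P' -> F i q by move=> /P'P[iP ki _]; apply/carpk.
apply: (IH P' (fun i => slice (F i) q n) ((dotp n n)^-1 *: n)).
- apply: leq_trans PN; apply: fproper_ltn_card; rewrite fproperE.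
  apply/andP; split; first by apply/fsubsetP => i /P'P[].
  by apply/negP => /fsubsetP/(_ k kP)/P'P[_ _]; rewrite ltxx.
- by move=> i iP'; have /P'P[iP _ _] := iP'; apply: polyhedral_slice; [apply: polF|apply: Fq].
- move=> i /P'P[iP ki mi].
  (* With [w = p i - q], being nearer to [x] than [q] says [dotp w w < 2 * dotp n w]. *)
  have h : 0 < dotp n (p i - q).
    move: mi; rewrite mkE /m nE; move: (p i - q) => w; have := dotp_ge0 w; rewrite !dotpE (dotpC w n); lra.
  exists ((dotp n (p i - q))^-1 *: (p i - q)); split.
    by rewrite dotpZr mulVf // gt_eqF.
  exists (dotp n (p i - q)) => //.
  by rewrite scalerA mulfV ?gt_eqF // scale1r addrC subrK; apply: Fp.
- move=> z [i0 /P'P[i0P ki0 _] [nz [e0 e0_gt0 Fe0]]].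
  have [e e_gt0 he] := ray_polyhedral_family q z polF.
  pose a := Num.min e e0.
  have a0 : 0 < a by rewrite lt_min e_gt0.
  have ae : a <= e by rewrite ge_min lexx.
  have Fi0q : F i0 q by apply/carpk.
  (* The least cell around [q + a *: z], for small [a], also has the least slice around [z]. *)
  have [|j jP hj] := car (q + a *: z).
    by exists i0 => //; have [_ h] := he a a0 ae _ i0P; apply: h Fe0.
  have Fj : F j (q + a *: z) by apply/hj.
  have [/(_ Fj) Fjq _] := he a a0 ae _ jP.
  exists j; first exact: (inP' j z a).
  move=> l lP'; have /P'P[lP kl _] := lP'; split=> [[_ [b b0 Fb]]|jl].
    by apply/hj => //; have [_ h] := he a a0 ae _ lP; apply: h Fb => //; apply: Fq.
  by split=> //; exists a => //; apply/hj.
- split.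
    (* The new center is the case [t = 0], with the cell [k] and the direction 0. *)
    have -> : (dotp n n)^-1 *: n = (1 - 0) *: ((dotp n n)^-1 *: n) + 0 *: (0 : pt).
      by rewrite subr0 scale1r scaler0 addr0.
    apply: supp'.
      by rewrite subr0 scale1r scaler0 addr0 dotpZr mulVf // gt_eqF.
    apply: (@cell_union_toward_center _ _ q n k 0 1); rewrite -?xE //; first by split; [exists ix|].
    - exact: Fp.
    - by rewrite scaler0 addr0; apply: Fp.
    - by rewrite lexx ler01.
  move=> y [i iP' [ny [e e0 Fe]]] t t01; have /P'P[iP _ _] := iP'.
  apply: supp'.
    rewrite dotpDr !dotpZr ny mulVf ?gt_eqF //; ring.
  apply: (@cell_union_toward_center _ _ q n i y e); rewrite -?xE //; first by split; [exists ix|].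
  exact: Fq.
Qed.

End StarShaped.

(** * Polytopes are polyhedra *)

Section FourierMotzkin.
Variables (R : realType) (d : nat).
Local Notation pt := 'rV[R]_d.
Implicit Types (x y s : pt) (t a : R) (S : seq pt) (L : seq (pt * R)).

(** Elimination of the variable [a]: the quotients [v k / u k] are lower bounds for [u k < 0] and
    upper bounds for [u k > 0], and a solution exists once every lower bound, 0 included, is at most
    every upper bound. *)
Lemma fourier_motzkin (T : eqType) (L : seq T) (u v : T -> R) :
  (exists2 a, 0 <= a & forall k, k \in L -> a * u k <= v k) <->
  (forall k, k \in L -> 0 <= u k -> 0 <= v k) /\
  (forall j k, j \in L -> k \in L -> u j < 0 -> 0 < u k -> u j * v k <= u k * v j).
Proof.
split=> [[a a0 h]|[h1 h2]].
  split=> [k kL uk|j k jL kL uj uk]; first by apply: le_trans (h k kL); rewrite mulr_ge0.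
  have := h j jL; have := h k kL; nra.
(* The largest of the lower bounds, 0 included. *)
pose a := \big[Num.max/0]_(j <- L | u j < 0) (v j / u j).
exists a; first exact: bigmax_ge_id.
move=> k kL; have [uk|uk|uk] := ltgtP (u k) 0.
- rewrite -ler_ndivrMr //; exact: (le_bigmax_seq 0 k (fun j => u j < 0) (fun j => v j / u j)).
- rewrite -ler_pdivlMr //; rewrite /a big_seq_cond.
  apply: bigmax_le => [|j /andP[jL uj]]; first by rewrite divr_ge0 ?h1 // ltW.
  rewrite ler_pdivlMr // mulrAC ler_ndivrMr //.
  by have := h2 _ _ jL kL uj uk; rewrite [_ * u j]mulrC [v j * _]mulrC.
- by rewrite uk mulr0 h1 // uk.
Qed.

(* conic S x t: (x, t) lies in the cone over the points (s, 1), s in S. *)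
Fixpoint conic S x t : Prop :=
  if S is s :: S' then exists2 a : R, 0 <= a & conic S' (x - a *: s) (t - a)
  else x = 0 /\ t = 0.

Lemma conicP S x t : conic S x t <-> exists w : 'I_(size S) -> R,
  (forall i, 0 <= w i) /\ \sum_i w i = t /\ x = \sum_i w i *: nth 0 S i.
Proof.
elim: S x t => [|s S IH] x t /=.
  split=> [[-> ->]|[w]]; last by rewrite !big_ord0 => -[_ [<- ->]].
  by exists (fun=> 0); rewrite !big_ord0.
split=> [[a a0 /IH[w [w0 [wt wx]]]]|[w [w0 [wt wx]]]].
  exists (fun i => oapp w a (unlift ord0 i)); split.
    by move=> i; case: unliftP => [j _|_] /=.
  rewrite !big_ord_recl unlift_none /=; split.
    by under eq_bigr do rewrite liftK; rewrite /= wt addrC subrK.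
  under eq_bigr do rewrite liftK /=.
  by rewrite -wx addrC subrK.
exists (w ord0) => //; apply/IH; exists (fun i => w (lift ord0 i)); split=> //.
move: wt wx; rewrite !big_ord_recl /= => <- ->.
by rewrite [w ord0 + _]addrC [w ord0 *: s + _]addrC !addrK.
Qed.

(** Each generator [s] of the cone brings in one nonnegative coefficient, which Fourier-Motzkin
    elimination removes again. *)
Lemma conic_halfspaces S : exists L, forall x t,
  conic S x t <-> forall k, k \in L -> dotp k.1 x <= k.2 * t.
Proof.
elim: S => [|s S [L LP]].
  pose e i : pt := delta_mx 0 i.
  have eE i x : dotp (e i) x = x 0 i.
    rewrite /dotp (bigD1 i) //= big1 => [|j ji]; rewrite !mxE ?eqxx ?mul1r ?addr0 //.
    by rewrite (negPf ji) mul0r.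
  exists ((0, 1) :: (0, - 1) :: [seq (e i, 0 : R) | i <- enum 'I_d]
           ++ [seq (- e i, 0 : R) | i <- enum 'I_d]) => x t.
  split=> /= [[-> ->] k|h]; first by rewrite dotp0r mulr0.
  have t0 : t = 0.
    have := h (0, 1); have := h (0, - 1); rewrite !inE !eqxx !orbT /= dotpC dotp0r.
    by move=> /(_ isT) h1 /(_ isT) h2; lra.
  split=> //; apply/rowP => i; rewrite mxE; apply/eqP; rewrite eq_le -{1}eE -oppr_le0 -eE -dotpNl.
  have iE : i \in enum 'I_d by rewrite mem_enum.
  have := h (e i, 0); have := h (- e i, 0).
  rewrite !inE !mem_cat /= (map_f (fun i => (e i, 0))) // (map_f (fun i => (- e i, 0))) //.
  by rewrite !orbT mul0r => /(_ isT) -> /(_ isT) ->.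
(* [u k] is the slack of the inequality [k] at [(s, 1)], and [v k] below its slack at [(x, t)]; at
   [(x - a *: s, t - a)] the slack is [v k - a * u k]. *)
pose u (k : pt * R) := k.2 - dotp k.1 s.
exists ([seq k <- L | 0 <= u k] ++
  [seq (u k *: j.1 - u j *: k.1, u k * j.2 - u j * k.2) |
     j <- [seq j <- L | u j < 0], k <- [seq k <- L | 0 < u k]]) => x t /=.
pose v (k : pt * R) := k.2 * t - dotp k.1 x.
have step a : conic S (x - a *: s) (t - a) <-> forall k, k \in L -> a * u k <= v k.
  by split=> [/LP h k kL|h]; [have := h _ kL|apply/LP => k kL; have := h _ kL];
    rewrite /u /v dotpBr dotpZr; lra.
have -> : (exists2 a, 0 <= a & conic S (x - a *: s) (t - a)) <->
    (exists2 a, 0 <= a & forall k, k \in L -> a * u k <= v k).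
  by split=> -[a a0 /step]; exists a.
rewrite fourier_motzkin; split=> [[h1 h2] k|h].
  rewrite mem_cat mem_filter => /orP[/andP[uk kL]|].
    by have := h1 k kL uk; rewrite /v subr_ge0.
  move=> /allpairsP[[i j] /=]; rewrite !mem_filter => -[/andP[ui iL] /andP[uj jL] ->] /=.
  have := h2 _ _ iL jL ui uj; rewrite /v !dotpE; lra.
split=> [k kL uk|i j iL jL ui uj].
  by rewrite /v subr_ge0; apply: h; rewrite mem_cat mem_filter uk kL.
have := h (u j *: i.1 - u i *: j.1, u j * i.2 - u i * j.2).
rewrite mem_cat /= (_ : _ \in allpairs _ _ _) ?orbT; last first.
  by apply/allpairsP; exists (i, j); rewrite !mem_filter ui uj iL jL.
by move=> /(_ isT); rewrite /v !dotpE; lra.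
Qed.

Lemma polytope_polyhedral (P : set pt) : polytope P -> polyhedral P.
Proof.
case=> S ->; have [L LP] := conic_halfspaces S; exists L.
apply/seteqP; split=> x; first by move=> /conicP/LP h k /h; rewrite mulr1.
by move=> h; apply/conicP/LP => k /h; rewrite mulr1.
Qed.

End FourierMotzkin.

(** * Star-shaped polytopal complexes *)

Section PolytopalComplexes.
Variables (R : realType) (d : nat).
Implicit Types (C : {fset set 'rV[R]_d}).
Local Open Scope fset_scope.

(** Two cells meet in a common face, so the intersection of all cells through [y] is again a
    cell. *)
Lemma polytopal_carrier C y : polytopal_complex C -> underlying C y ->
  exists k, [/\ k \in C, k y & forall j, j \in C -> j y <-> (k `<=` j)%classic].
Proof.
move=> [_ Cf CI] [P0 P0C P0y].
suff [k [kC ky kj]] : exists k, [/\ k \in C, k y &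
    forall j, j \in (C : seq _) -> j \in C -> j y -> (k `<=` j)%classic].
  by exists k; split=> // j jC; split=> [|]; [apply: kj|apply].
elim: (C : seq _) => [|j s [k [kC ky kj]]]; first by exists P0.
have [[jC jy]|njy] := pselect (j \in C /\ j y); last first.
  exists k; split=> // l; rewrite inE => /orP[/eqP ->|]; last exact: kj.
  by move=> jC jy; case: njy.
exists (k `&` j)%classic; split=> //.
  have [kjk _] := CI _ _ kC jC; apply: (Cf _ _ kC kjk) => e.
  by have : (k `&` j)%classic y by []; rewrite e.
move=> l; rewrite inE => /orP[/eqP -> _ _|ls lC ly]; first by move=> z [].
by move=> z [kz _]; apply: (kj l).
Qed.

Lemma nonevasive_sd_polytopal C : star_shaped (underlying C) -> polytopal_complex C ->
  nonevasive (sd_polytopal C).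
Proof.
move=> [x xC star] cC; set P := [fset Q in C | Q != set0].
have inP Q : (Q \in P) = (Q \in C) && (Q != set0) by rewrite !inE.
have supE : cell_union P (fun Q => Q) = underlying C.
  apply/seteqP; split=> y [Q QC Qy]; exists Q => //.
    by move: QC; rewrite inP => /andP[].
  by rewrite inP QC /=; apply/eqP => Q0; rewrite Q0 in Qy.
apply: (@star_nonevasive R d _ _ _ _ P (fun Q => Q) x) => /=.
- by move=> Q y.
- by move=> Q1 Q2 Q3 h1 h2 y /h1/h2.
- by move=> Q; rewrite inP => /andP[QC _]; apply: polytope_polyhedral; case: cC => h _ _; apply: h.
- by move=> Q; rewrite inP => /andP[_] /set0P.
- move=> y; rewrite supE => /(polytopal_carrier cC)[k [kC ky kj]]; exists k.
    by rewrite inP kC /=; apply/set0P; exists y.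
  by move=> j; rewrite inP => /andP[jC _]; apply: kj.
- by rewrite supE.
Qed.

End PolytopalComplexes.

(** * Euler characteristic and connectedness *)

Section Euler.
Variable V : choiceType.
Local Open Scope fset_scope.
Implicit Types (K L : asc V) (v w a b : V) (s t : {fset V}).

(** The leading sign is there because a face with [n] vertices has dimension [n - 1]. *)
Definition chi K : int := - \sum_(s <- K) (-1) ^+ #|` s|.

Lemma chi0 : chi fset0 = 0.
Proof. by rewrite /chi big_seq_fset0 oppr0. Qed.

(** A face through [v] other than [[fset v]] is [v] joined to a face of the link, and counts with
    the opposite sign. *)
Lemma chi_vertex K v : face_closed K -> is_vertex K v ->
  chi K = chi (deletion K v) + 1 - chi (link K v).
Proof.
move=> cK vK; rewrite /chi (bigID (fun s => v \in s)) /= opprK.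
have -> : \sum_(s <- K | v \notin s) (-1) ^+ #|` s| =
    \sum_(s <- deletion K v) (-1) ^+ #|` s| :> int.
  by rewrite /deletion big_fset_condE.
have vl s : s \in link K v -> v \notin s by rewrite in_link => /and3P[].
have -> : \sum_(s <- K | v \in s) (-1) ^+ #|` s| =
    \sum_(s <- [fset v] |` [fset v |` s | s in link K v]) (-1) ^+ #|` s| :> int.
  rewrite big_fset_condE; apply: congr_big => //; congr (enum_fset _).
  apply/fsetP => s; rewrite in_fset1U mem_cone //; apply/idP/orP.
    move=> sKv; have /andP[sK vs] : (s \in K) && (v \in s) by move: sKv; rewrite !inE.
    have [->|[t tl ->]] := face_with_vertexP cK sK vs; first by left.
    by right; rewrite fset1U1 fsetU1K ?vl.
  case=> [/eqP ->|/andP[vs]]; first by rewrite !inE /= eqxx andbT.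
  by rewrite in_link fsetD1K // => /and3P[_ _ sK]; rewrite !inE sK.
rewrite big_fsetU1 /=; last first.
  rewrite mem_cone // fset11 fsetDv; have [l0 _] := face_closed_link v cK.
  exact: l0.
rewrite big_imfset /=; last first.
  by move=> s t sl tl; apply: fset_add_inj; apply: vl.
rewrite cardfs1 expr1 big_seq.
under eq_bigr => s sl do rewrite cardfsU1 (vl _ sl) exprS mulN1r.
rewrite -big_seq sumrN; ring.
Qed.

Lemma nonevasive_chi K : face_closed K -> nonevasive K -> chi K = 1.
Proof.
move=> + nK; elim: nK => {K} [v _|K v vK _ _ IHl _ IHd cK].
  by rewrite /chi big_seq_fset1 cardfs1 expr1 opprK.
by rewrite (chi_vertex cK vK) IHl ?IHd; [lia|apply: face_closed_deletion|apply: face_closed_link].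
Qed.

Definition faces_of s : asc V := [fset t in fpowerset s | t != fset0].

Lemma in_faces_of s t : (t \in faces_of s) = (t != fset0) && (t `<=` s).
Proof. by rewrite !inE fpowersetE andbC. Qed.

(** In a full simplex the link and the deletion of a vertex are the same complex and cancel in
    [chi_vertex]. *)
Lemma chi_simplex s : s != fset0 -> chi (faces_of s) = 1.
Proof.
case/fset0Pn => v vs.
have cS : face_closed (faces_of s).
  split=> [|t u]; rewrite !in_faces_of ?eqxx // => /andP[_ ts] ut -> /=.
  exact: fsubset_trans ts.
have vS : is_vertex (faces_of s) v.
  rewrite /is_vertex in_faces_of fsub1set vs andbT.
  by apply/fset0Pn; exists v; rewrite fset11.
rewrite (chi_vertex cS vS) (_ : link _ v = deletion (faces_of s) v); first by lia.
apply/fsetP => t; rewrite in_link in_deletion; apply/and3P/andP => -[] //.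
rewrite !in_faces_of => /andP[t0 ts] vt; split=> //; first by rewrite t0.
rewrite fsubUset fsub1set vs ts !andbT.
by apply/fset0Pn; exists v; rewrite in_fset1U eqxx.
Qed.

(** Connectedness of the edge graph, phrased through predicates that propagate along edges so that
    no paths have to be built. *)
Definition connected K : Prop := forall A : V -> Prop,
  (forall a b, [fset a; b] \in K -> A a -> A b) ->
  forall a b, is_vertex K a -> is_vertex K b -> A a -> A b.

(** A vertex [w] of the link is adjacent to [v], and the deletion, connected by induction, joins [w]
    to all other vertices. *)
Lemma nonevasive_connected K : nonevasive K -> connected K.
Proof.
elim=> {K} [v A _ a b|K v vK _ nl _ _ IHd A AK].
  rewrite /is_vertex !in_fset1 => /eqP/fset1_inj -> /eqP/fset1_inj -> //.
have [w /link_vertexP[wK wv vw]] := nonevasive_vertex nl.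
have dv a : a != v -> is_vertex K a -> is_vertex (deletion K v) a.
  by rewrite /is_vertex in_deletion in_fset1 eq_sym => -> ->.
have Aw a : is_vertex K a -> A a -> A w.
  have [->|av aK] := eqVneq a v; first by move=> _; apply: AK.
  apply: IHd (dv _ av aK) (dv _ wv wK) => b c; rewrite in_deletion => /andP[+ _].
  exact: AK.
move=> a b aK bK /(Aw _ aK).
have [->|bv] := eqVneq b v; first by apply: AK; rewrite fsetUC.
apply: IHd (dv _ wv wK) (dv _ bv bK) => c e; rewrite in_deletion => /andP[+ _].
exact: AK.
Qed.

End Euler.

Section EulerSd.
Variable V : choiceType.
Local Open Scope fset_scope.
Implicit Types (K : asc V) (s t : {fset V}).

(** Remove a face [s] with the largest number n of vertices. Its link in [sd K] is the subdivided
    boundary of [s], of Euler characteristic 1 + (-1)^n, so both sides change by the same amount. *)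
Lemma chi_sd K : face_closed K -> chi (sd K) = chi K.
Proof.
have [n] := ubnP #|` K|; elim: n => // n IH in K *; rewrite ltnS => Kn cK.
have [->|K0] := eqVneq K fset0.
  suff -> : sd fset0 = fset0 :> {fset {fset {fset V}}} by rewrite chi0 /chi big_seq_fset0 oppr0.
  apply/fsetP => c; rewrite in_fset0; apply/negP => /order_complexP[+ c0 _].
  by rewrite fsubset0 (negPf c0).
have [s sK smax] := fset_argmin (fun s : {fset V} => - (#|` s|)%:Z) K0.
have {}smax t : t \in K -> (#|` t| <= #|` s|)%N by move=> /smax; lia.
have s0 : s != fset0 by case: cK => K00 _; apply: contraNneq K00 => <-.
have ltK (K' : asc V) : K' `<=` K `\ s -> (#|` K'| < n)%N.
  move=> /fsubset_leq_card h; apply: leq_ltn_trans h _.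
  by rewrite (leq_trans _ Kn) // [X in (_ < X)%N](cardfsD1 s) sK.
have cK' : face_closed (K `\ s).
  case: cK => K00 Kc; split=> [|t u]; rewrite !in_fsetD1 ?(negPf K00) ?andbF //.
  move=> /andP[ts tK] ut u0; rewrite (Kc t) // andbT.
  apply: contra ts => /eqP us; rewrite eq_sym eqEfcard.
  by rewrite -{1}us ut smax.
have compE : comparables (fun s t => s `<=` t) K s = faces_of s `\ s.
  apply/fsetP => t; rewrite in_fsetD1 in_faces_of.
  apply/comparablesP/and3P => [[tK ts h]|[ts t0 sub]]; split=> //.
  - by case: cK => K00 _; apply: contraNneq K00 => <-.
  - case: h => // st; have := smax _ tK; move: ts; rewrite eq_sym eqEfcard st /=.
    by move=> /negPf ->.
  - by case: cK => _ h; apply: (h s).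
  - by left.
have cB : face_closed (faces_of s `\ s).
  split=> [|t u]; rewrite !in_fsetD1 !in_faces_of ?eqxx ?andbF //.
  move=> /and3P[ts t0 sub] ut ->; rewrite (fsubset_trans ut) // !andbT.
  apply: contra ts => /eqP us; rewrite eqEfsubset sub -us //=.
have fx (t : {fset V}) : t `<=` t by [].
have vsd : is_vertex (sd K) s by rewrite is_vertex_order_complex.
have sdc : face_closed (sd K) by apply: face_closed_order_complex.
rewrite (chi_vertex sdc vsd) /sd deletion_order_complex link_order_complex // compE.
rewrite -[order_complex (K `\ s) _]/(sd _) -[order_complex (_ `\ s) _]/(sd _).
rewrite !IH //; first last.
- exact: ltK.
- apply: ltK; apply/fsubsetP => t; rewrite !in_fsetD1 in_faces_of => /and3P[-> t0 ts].
  by case: cK => _ h; apply: (h s).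
have chiD (K' : asc V) : s \in K' -> chi K' = chi (K' `\ s) - (-1) ^+ #|` s|.
  by move=> sK'; rewrite /chi (big_fsetD1 s) //= opprD addrC.
rewrite (chiD K) //; have := chi_simplex s0; rewrite chiD ?in_faces_of ?s0 //=; lia.
Qed.

(** The predicate [A] is carried to the faces having some vertex in [A]. It propagates because
    adjacent vertices of [sd K] are nested faces and any two vertices of a face span an edge. *)
Lemma connected_sd K :
  face_closed K -> connected (sd K) -> connected K.
Proof.
move=> [K0 Kc] con A AK a b aK bK Aa.
have lexx (s : {fset V}) : (s `<=` s)%fset by [].
have [//||||c /fset1P -> //] := con (fun s => exists2 c, c \in s & A c) _ [fset a]%fset [fset b]%fset.
- move=> s t /order_complexP[sub _ cmp] [c cs Ac].
  have sK : s \in K by apply: (fsubsetP sub); rewrite !inE eqxx.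
  have tK : t \in K by apply: (fsubsetP sub); rewrite !inE eqxx orbT.
  have [st|ts] : (s `<=` t \/ t `<=` s)%fset by apply: cmp; rewrite !inE eqxx ?orbT.
    by exists c => //; apply: (fsubsetP st).
  have /fset0Pn[e et] : t != fset0 by apply: contraNneq K0 => <-.
  exists e => //; apply: AK Ac; apply: (Kc s) => //.
    by rewrite fsubUset !fsub1set cs (fsubsetP ts).
  by apply/fset0Pn; exists c; rewrite !inE eqxx.
- by rewrite is_vertex_order_complex.
- by rewrite is_vertex_order_complex.
- by exists a; rewrite ?fset11.
Qed.

End EulerSd.

(** * Planar complexes *)

Section LinearForests.
Variable V : choiceType.
Local Open Scope fset_scope.
Implicit Types (K G : asc V) (v a b c : V) (s t : {fset V}) (r : V -> V -> Prop).

Lemma face_vertex K s a : face_closed K -> s \in K -> a \in s -> is_vertex K a.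
Proof.
move=> [_ Kc] sK aS; apply: (Kc s) => //; first by rewrite fsub1set.
by apply/fset0Pn; exists a; rewrite fset11.
Qed.

Lemma link_vertex K v w : face_closed K -> [fset v; w] \in K -> w <> v ->
  is_vertex (link K v) w.
Proof.
move=> cK vw wv; rewrite /is_vertex in_link in_fset1 vw; apply/and3P; split=> //.
  by apply: (face_vertex cK vw); rewrite !inE eqxx orbT.
by apply/eqP => e; apply: wv.
Qed.

Lemma face_nonempty K s : face_closed K -> s \in K -> exists a, a \in s.
Proof. by move=> [K0 _] sK; apply/fset0Pn; apply: contraNneq K0 => <-. Qed.

Lemma is_vertex_deletion K v a : is_vertex (deletion K v) a = is_vertex K a && (v != a).
Proof. by rewrite /is_vertex in_deletion in_fset1. Qed.

Lemma deletion_ltn K v : is_vertex K v -> (#|` deletion K v| < #|` K|)%N.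
Proof.
move=> vK; apply: fproper_ltn_card; rewrite fproperE; apply/andP; split.
  by apply/fsubsetP => s; rewrite in_deletion => /andP[].
by apply/negP => /fsubsetP/(_ _ vK); rewrite in_deletion fset11 andbF.
Qed.

Definition strict_order (D : V -> Prop) r : Prop :=
  [/\ forall a b c, D a -> D b -> D c -> r a b -> r b c -> r a c,
      forall a, D a -> ~ r a a &
      forall a b, D a -> D b -> a <> b -> r a b \/ r b a].

Lemma strict_orderW (D D' : V -> Prop) r :
  (forall a, D' a -> D a) -> strict_order D r -> strict_order D' r.
Proof.
move=> DD [tr irr tot]; split=> [a b c|a|a b] => *; [apply: (tr a b c)|apply: irr|apply: tot];
by [|apply: DD].
Qed.

Lemma strict_order_flip (D : V -> Prop) r :
  strict_order D r -> strict_order D (fun a b => r b a).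
Proof.
move=> [tr irr tot]; split=> // [a b c Da Db Dc ab bc|a b Da Db ab].
  exact: (tr c b a).
by case: (tot a b Da Db ab); [right|left].
Qed.

Lemma max_vertex K r : face_closed K -> K != fset0 -> strict_order (is_vertex K) r ->
  exists2 u, is_vertex K u & forall a, is_vertex K a -> a <> u -> r a u.
Proof.
move=> cK /fset0Pn[s0 s0K] [tr irr tot].
have [v0 /(face_vertex cK s0K) v0K] := face_nonempty cK s0K.
suff [u uK umax] : exists2 u, is_vertex K u &
    forall a, [fset a] \in (K : seq _) -> is_vertex K a -> a <> u -> r a u.
  by exists u => // a aK; apply: umax.
elim: (K : seq _) => [|t l [u uK umax]]; first by exists v0.
have [[w [wt wK uw wu]]|no] := pselect (exists w, [/\ t = [fset w], is_vertex K w, r u w & w <> u]).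
  exists w => // a; rewrite inE => /orP[/eqP|al aK aw].
    by rewrite wt => /fset1_inj ->.
  have [->//|au] := pselect (a = u).
  exact: (tr a u w) (umax _ al aK au) uw.
exists u => // a; rewrite inE => /orP[/eqP at_ aK au|]; last exact: umax.
have [//|ua] := tot _ _ aK uK au.
by case: no; exists a.
Qed.

(** Encodes a disjoint union of paths laid out along [r]: only consecutive vertices can be joined,
    which excludes triangles as well. *)
Definition linear_forest r G : Prop := strict_order (is_vertex G) r /\
  forall a b c, [fset a; b] \in G -> is_vertex G c -> r a c -> r c b -> False.

(** [chi] counts the components. The greatest vertex has at most one neighbour: with none it is a
    new component and adds 1, with one it prolongs a path and adds nothing. *)
Lemma linear_forest_chi r G : face_closed G -> linear_forest r G -> G != fset0 ->
  1 <= chi G /\ (chi G = 1 -> nonevasive G).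
Proof.
have [n] := ubnP #|` G|; elim: n => // n IH in G *; rewrite ltnS => Gn cG [so btw] G0.
have [u uG umax] := max_vertex cG G0 so.
have cl := face_closed_link u cG; have cd := face_closed_deletion u cG.
have lG a : is_vertex (link G u) a -> [/\ is_vertex G a, a != u & [fset a; u] \in G].
  by move=> /link_vertexP[aG au]; rewrite fsetUC.
(* Of two distinct neighbours of [u], the larger would lie between the ends of the edge from the
   smaller to [u]. *)
have nbr1 a b : is_vertex (link G u) a -> is_vertex (link G u) b -> a = b.
  move=> /lG[aG /eqP au auG] /lG[bG /eqP bu buG]; apply: contrapT => ab.
  have [_ _ tot] := so; case: (tot _ _ aG bG ab) => rab.
    by apply: (btw a u b) => //; apply: umax.
  by apply: (btw b u a) => //; apply: umax.
have link1 s : s \in link G u -> exists2 w, is_vertex (link G u) w & s = [fset w].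
  move=> sl; have [w ws] := face_nonempty cl sl; have wl := face_vertex cl sl ws.
  exists w => //; apply/fsetP => a; rewrite in_fset1; apply/idP/eqP => [as_|->//].
  exact: nbr1 (face_vertex cl sl as_) wl.
have lf : linear_forest r (deletion G u).
  split; first by apply: strict_orderW so => a; rewrite is_vertex_deletion => /andP[].
  move=> a b c; rewrite in_deletion is_vertex_deletion => /andP[abG _] /andP[cG' _].
  exact: btw.
have chiG := chi_vertex cG uG.
have [d0|d0] := eqVneq (deletion G u) fset0.
  have l0 : link G u = fset0.
    apply/fsetP => s; rewrite in_fset0; apply/negP; rewrite in_link => /and3P[sG us _].
    by have := in_fset0 s; rewrite -d0 in_deletion sG us.
  rewrite chiG d0 l0 chi0; split=> // _.
  suff -> : G = [fset [fset u]] by apply: nonevasive_point.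
  apply/fsetP => s; rewrite in_fset1; apply/idP/eqP => [sG|->//].
  have us : u \in s.
    by apply: contraT => us; have := in_fset0 s; rewrite -d0 in_deletion sG us.
  by have [//|[t]] := face_with_vertexP cG sG us; rewrite l0.
have [|hd nd] := IH _ _ cd lf d0.
  by apply: leq_trans Gn; apply: deletion_ltn.
have [l0|/fset0Pn[s sl]] := eqVneq (link G u) fset0.
  (* Here [chi G >= 2], so the second claim is vacuous. *)
  by rewrite chiG l0 chi0; split; [lia|move=> h; exfalso; lia].
have [w wl sw] := link1 _ sl.
have lE : link G u = [fset [fset w]].
  apply/fsetP => t; rewrite in_fset1; apply/idP/eqP => [/link1[w' w'l ->]|->//].
  by rewrite (nbr1 w' w).
have nl : nonevasive (link G u) by rewrite lE; apply: nonevasive_point.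
rewrite chiG (nonevasive_chi cl nl) addrK; split=> // /nd.
exact: nonevasive_vertex_step.
Qed.

End LinearForests.

Section Planar.
Variable V : choiceType.
Local Open Scope fset_scope.
Implicit Types (K G : asc V) (v a b c : V) (s t : {fset V}) (lt : V -> V -> Prop).
Implicit Types (ang : V -> V -> V -> Prop).

Definition uplink lt K v : asc V :=
  [fset s in link K v | `[< forall a, a \in s -> lt v a >]].

Lemma uplinkP lt K v s : reflect
  (s \in link K v /\ forall a, a \in s -> lt v a) (s \in uplink lt K v).
Proof.
by rewrite /uplink !inE; apply: (iffP andP) => -[sl /asboolP h]; split=> //; apply/asboolP.
Qed.

Lemma face_closed_uplink lt K v : face_closed K -> face_closed (uplink lt K v).
Proof.
move=> /(face_closed_link v)[l0 lc]; split; first by apply/uplinkP => -[]; rewrite (negPf l0).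
move=> s t /uplinkP[sl sv] ts t0; apply/uplinkP; split; first exact: (lc s).
by move=> a /(fsubsetP ts); apply: sv.
Qed.

Definition vertices K : {fset V} := \bigcup_(s <- K) s.

Lemma in_vertices K v : face_closed K -> (v \in vertices K) = is_vertex K v.
Proof.
move=> cK; apply/bigfcupP/idP => [[s /andP[sK _]]|vK]; first exact: face_vertex.
by exists [fset v]; rewrite ?fset11 ?andbT.
Qed.

(* Each face is counted at its lt-least vertex. *)
Lemma chi_uplinks lt K : face_closed K -> strict_order (is_vertex K) lt ->
  chi K = \sum_(v <- vertices K) (1 - chi (uplink lt K v)).
Proof.
have [n] := ubnP #|` K|; elim: n => // n IH in K *; rewrite ltnS => Kn cK so.
have [K0|K0] := eqVneq K fset0.
  by rewrite K0 chi0 /vertices !big_seq_fset0.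
(* The least vertex [u] has its whole link above it and lies in no other upper link, so deleting it
   removes one summand and leaves the others unchanged. *)
have [u uK umin] := max_vertex cK K0 (strict_order_flip so).
have cd := face_closed_deletion u cK.
have so' : strict_order (is_vertex (deletion K u)) lt.
  by apply: strict_orderW so => a; rewrite is_vertex_deletion => /andP[].
have uv : u \in vertices K by rewrite in_vertices.
rewrite (big_fsetD1 u) //= (chi_vertex cK uK) (IH (deletion K u)) //; last first.
  by apply: leq_trans Kn; apply: deletion_ltn.
have -> : uplink lt K u = link K u.
  apply/fsetP => s; apply/uplinkP/idP => [[]//|sl]; split=> // a as_.
  have /link_vertexP[aK /eqP au _] := face_vertex (face_closed_link u cK) sl as_.
  exact: umin.
have -> : vertices (deletion K u) = vertices K `\ u.
  by apply/fsetP => a; rewrite in_fsetD1 !in_vertices // is_vertex_deletion andbC eq_sym.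
set S := (X in (X + 1 - _)%R); set S' := (X in _ = (_ + X)%R).
suff -> : S = S' by ring.
rewrite /S /S' big_seq [RHS]big_seq.
apply: eq_bigr => a; rewrite in_fsetD1 in_vertices // => /andP[/eqP au aK].
congr (1 - chi _); apply/fsetP => s.
apply/uplinkP/uplinkP => -[]; rewrite !in_link !in_deletion.
  by case/and3P=> /andP[sK us] as_ /andP[asK _] h; split=> //; apply/and3P.
case/and3P=> sK as_ asK h; split=> //; rewrite sK as_ asK.
have us : u \notin s.
  apply/negP => /h au'; have [tr irr _] := so.
  by apply: (irr a aK); apply: (tr a u a) => //; apply: umin.
by rewrite us in_fset1U negb_or us; move/eqP: au; rewrite eq_sym => ->.
Qed.

(* In the plane, ang v compares the directions from v; the two half planes
   bounded by a line through v must be treated apart for it to be an order. *)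
Definition fan lt ang K v : Prop := linear_forest (ang v) (uplink lt K v).

(** The combinatorial trace of planarity on which the induction runs; it passes to vertex
    deletions. *)
Definition planar lt ang K : Prop :=
  [/\ strict_order (is_vertex K) lt,
      forall v, fan lt ang K v & forall v, fan (fun a b => lt b a) ang K v].

Lemma linear_forestW (r : V -> V -> Prop) G G' : G' `<=` G ->
  linear_forest r G -> linear_forest r G'.
Proof.
move=> /fsubsetP sub [so btw]; split; first by apply: strict_orderW so => a /sub.
by move=> a b c /sub abG /sub; apply: btw.
Qed.

Lemma uplink_deletion_sub lt K u v : uplink lt (deletion K u) v `<=` uplink lt K v.
Proof.
apply/fsubsetP => s /uplinkP[]; rewrite in_link !in_deletion.
by case/and3P=> /andP[sK _] vs /andP[vsK _] h; apply/uplinkP; split=> //; rewrite in_link sK vs.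
Qed.

Lemma planar_deletion lt ang K u : planar lt ang K -> planar lt ang (deletion K u).
Proof.
move=> [so up dn]; split.
- by apply: strict_orderW so => a; rewrite is_vertex_deletion => /andP[].
- by move=> v; apply: linear_forestW (up v); apply: uplink_deletion_sub.
- by move=> v; apply: linear_forestW (dn v); apply: uplink_deletion_sub.
Qed.

(** A passage through [v] can be rerouted in its link: [B] extends [A] to [v] by its value on the
    link, constant because the link is connected. *)
Lemma connected_deletion K v : face_closed K -> connected K -> connected (link K v) ->
  connected (deletion K v).
Proof.
move=> cK con cl A Adel a b; rewrite !is_vertex_deletion => /andP[aK va] /andP[bK vb] Aa.
pose B w := (w <> v /\ A w) \/ (w = v /\ exists2 c, is_vertex (link K v) c & A c).
have Al c e : is_vertex (link K v) c -> is_vertex (link K v) e -> A c -> A e.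
  apply: cl => x y; rewrite in_link => /and3P[xyK vxy _]; apply: Adel.
  by rewrite in_deletion xyK.
suff : B b by case=> [[]//|[bv _]]; rewrite bv eqxx in vb.
apply: (con B _ a b) => //; last by left; split=> // av; rewrite av eqxx in va.
move=> x y xyK Bx; have [yE|yv] := pselect (y = v).
  case: Bx => [[xv Ax]|[_ h]]; right; split=> //; exists x => //.
  by apply: link_vertex xv => //; rewrite fsetUC -yE.
left; split=> //; case: Bx => [[/eqP xv Ax]|[xv [c cl' Ac]]].
  apply: Adel Ax; rewrite in_deletion xyK !inE negb_or eq_sym xv eq_sym.
  exact/eqP.
by apply: Al cl' _ Ac; apply: link_vertex => //; rewrite -xv.
Qed.

(** All neighbours of [v] lie on one side, so the link is a linear forest of Euler characteristic at
    most 1, hence a single path; deleting [v] then preserves connectedness and [chi]. *)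
Lemma planar_nonevasive_step lt ang K v : face_closed K -> connected K -> chi K = 1 ->
  is_vertex K v -> fan lt ang K v -> strict_order (is_vertex K) lt ->
  uplink lt K v != fset0 -> chi (uplink lt K v) <= 1 ->
  uplink (fun a b => lt b a) K v = fset0 ->
  [/\ nonevasive (link K v), connected (deletion K v) & chi (deletion K v) = 1].
Proof.
move=> cK con chiK vK fv [_ _ tot] up0 up1 dn0.
have lE : uplink lt K v = link K v.
  apply/fsetP => s; apply/uplinkP/idP => [[]//|sl]; split=> // a as_.
  have al := face_vertex (face_closed_link v cK) sl as_.
  have [aK /eqP av _] := link_vertexP al.
  have [//|va|av'] := tot v a vK aK; first by move=> e; case: av.
    exact: va.
  have := in_fset0 [fset a]; rewrite -dn0 => /negP[]; apply/uplinkP; split=> //.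
  by move=> b /fset1P ->.
have [h1 h2] := linear_forest_chi (face_closed_uplink lt v cK) fv up0.
have c1 : chi (uplink lt K v) = 1 by lia.
have nl : nonevasive (link K v) by rewrite -lE; apply: h2.
split=> //; first exact: connected_deletion (nonevasive_connected nl).
by have := chi_vertex cK vK; rewrite -lE c1 chiK; lia.
Qed.

(* Summing the counts of chi_uplinks for lt and its converse, the value
   2 chi K > 0 forces a vertex one of whose two half links is empty and the
   other empty or of Euler characteristic 1. *)
Theorem planar_nonevasive lt ang K : face_closed K -> planar lt ang K ->
  connected K -> chi K = 1 -> nonevasive K.
Proof.
have [n] := ubnP #|` K|; elim: n => // n IH in K *; rewrite ltnS => Kn cK pl con chiK.
have [so up dn] := pl.
pose gt a b := lt b a.
pose f v : int := ((1 - chi (uplink lt K v)) + (1 - chi (uplink gt K v)))%R.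
have [v vK fv] : exists2 v, is_vertex K v & 0 < f v.
  apply: contrapT => no; suff : \sum_(v <- vertices K) f v <= 0.
    rewrite big_split -!chi_uplinks //; last exact: strict_order_flip.
    by rewrite chiK.
  rewrite big_seq; apply: sumr_le0 => v; rewrite in_vertices // => vK.
  by rewrite leNgt; apply/negP => fv; apply: no; exists v.
have step : nonevasive (link K v) -> connected (deletion K v) ->
    chi (deletion K v) = 1 -> nonevasive K.
  move=> nl cond chid; apply: (nonevasive_vertex_step vK nl); apply: IH => //.
  - by apply: leq_trans Kn; apply: deletion_ltn.
  - exact: face_closed_deletion.
  - exact: planar_deletion.
have chi_half l : fan l ang K v -> uplink l K v != fset0 -> 1 <= chi (uplink l K v).
  by move=> fl l0; have [] := linear_forest_chi (face_closed_uplink l v cK) fl l0.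
have [u0|u0] := eqVneq (uplink lt K v) fset0; have [d0|d0] := eqVneq (uplink gt K v) fset0.
(* An isolated vertex of a connected complex is the whole complex. *)
- suff -> : K = [fset [fset v]] by apply: nonevasive_point.
  have nolink a : is_vertex (link K v) a -> False.
    move=> al; have [aK /eqP av _] := link_vertexP al.
    have [_ _ tot] := so; have [e|h|h] := tot v a vK aK; first by case: av.
      have := in_fset0 [fset a]; rewrite -u0 => /negP[]; apply/uplinkP; split=> //.
      by move=> b /fset1P ->.
    have := in_fset0 [fset a]; rewrite -d0 => /negP[]; apply/uplinkP; split=> //.
    by move=> b /fset1P ->.
  have only a : is_vertex K a -> a = v.
    move=> aK; apply: (con (fun b => b = v) _ v a) => // b c bcK bv; rewrite bv in bcK.
    by apply: contrapT => cv; apply: (nolink c); apply: link_vertex.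
  apply/fsetP => s; rewrite in_fset1; apply/idP/eqP => [sK|-> //].
  have [a as_] := face_nonempty cK sK; apply/fsetP => b; rewrite in_fset1.
  apply/idP/eqP => [bs|->]; first exact: only (face_vertex cK sK bs).
  by rewrite -(only a) //; apply: (face_vertex cK sK).
(* With one half link empty, [0 < f v] bounds the Euler characteristic of the other by 1. *)
- have [|] := planar_nonevasive_step (lt := gt) cK con chiK vK (dn v) (strict_order_flip so) d0 _ u0.
    by move: fv; rewrite /f u0 chi0; have := chi_half _ (dn v) d0; lia.
  exact: step.
- have [|] := planar_nonevasive_step cK con chiK vK (up v) so u0 _ d0.
    by move: fv; rewrite /f d0 chi0; have := chi_half _ (up v) u0; lia.
  exact: step.
(* Two nonempty half links would give [f v <= 0]. *)
- move: fv; rewrite /f; have := chi_half _ (up v) u0; have := chi_half _ (dn v) d0.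
  rewrite -/gt; lia.
Qed.

End Planar.

(** * Vertex schemes of simplicial complexes *)

Section Simplices.
Variables (R : realType) (d : nat).
Local Notation pt := 'rV[R]_d.
Implicit Types (S : seq pt) (c x p : pt) (b : R) (F G P Q : set pt).

(** Affine independence makes the rows [(s, 1)] of [M] linearly independent, so [M] has a right
    inverse and an affine function can take any prescribed values at the points. *)
Lemma aff_indep_functional S (v : 'I_(size S) -> R) : aff_indep S ->
  exists c b, forall i, dotp c (nth 0 S (i : 'I_(size S))) = b + v i.
Proof.
move=> indS; pose A : 'M[R]_(size S, d) := \matrix_(i, j) (nth 0 S i) 0 j.
pose M := row_mx A (const_mx 1 : 'M_(size S, 1)).
have fM : row_free M.
  apply: inj_row_free => w; rewrite mul_mx_row => /eqP; rewrite row_mx_eq0.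
  move=> /andP[/eqP wA /eqP w1]; apply/rowP => i; rewrite mxE.
  apply: (indS (fun i => w 0 i)).
    have w11 := congr1 (fun B : 'cV_1 => B 0 0) w1.
    apply: etrans (etrans w11 (mxE _ _ _ _)); rewrite [RHS]mxE.
    by apply: eq_bigr => j _; rewrite mxE mulr1.
  apply/rowP => j; have wAj := congr1 (fun B : 'rV_d => B 0 j) wA.
  rewrite summxE; apply: etrans wAj; rewrite [RHS]mxE.
  by apply: eq_bigr => k _; rewrite !mxE.
pose X := pinvmx M *m (\col_i v i).
have := mulmxVp fM; move/(congr1 (fun B => B *m (\col_i v i))); rewrite -mulmxA -/X mul1mx.
rewrite -[X]vsubmxK mul_row_col; set U := usubmx X; set D := dsubmx X => e.
exists U^T, (- D 0 0) => i.
have := congr1 (fun B : 'cV_(size S) => B i 0) e; rewrite !mxE big_ord1 !mxE mul1r => <-.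
rewrite addrCA addNr addr0; apply: eq_bigr => j _; rewrite !mxE mulrC //.
Qed.

Lemma conv_nth S (i : 'I_(size S)) : conv S (nth 0 S i).
Proof.
exists (fun j => (j == i)%:R); split=> [j|]; first exact: ler0n.
split; rewrite (bigD1 i) //= eqxx big1 ?addr0 ?scale1r // => j /negPf -> //.
by rewrite scale0r.
Qed.

Lemma conv_sub_polyhedral S G : polyhedral G ->
  (forall i : 'I_(size S), G (nth 0 S i)) -> (conv S `<=` G)%classic.
Proof.
case=> L -> h x [w [w0 [w1 ->]]] k kL; rewrite dotp_sumr.
rewrite -[k.2]mul1r -w1 mulr_suml; apply: ler_sum => i _.
by rewrite dotpZr ler_wpM2l // h.
Qed.

(** The gaps below [b], weighted by [w], are nonnegative and sum to 0, so each of them vanishes. *)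
Lemma conv_max S c b (w : 'I_(size S) -> R) : (forall i, 0 <= w i) -> \sum_i w i = 1 ->
  (forall i : 'I_(size S), dotp c (nth 0 S i) <= b) ->
  dotp c (\sum_i w i *: nth 0 S i) = b ->
  forall i, w i != 0 -> dotp c (nth 0 S i) = b.
Proof.
move=> w0 w1 cb; rewrite dotp_sumr => e i wi.
have h : \sum_i w i * (b - dotp c (nth 0 S i)) = 0.
  rewrite -[RHS](subrr b) -{3}e -[X in X - _]mul1r -w1 mulr_suml -sumrB.
  by apply: eq_bigr => j _; rewrite dotpZr mulrBr.
have pos j : 0 <= w j * (b - dotp c (nth 0 S (j : 'I_(size S)))).
  by rewrite mulr_ge0 // subr_ge0.
have /eqP : w i * (b - dotp c (nth 0 S i)) = 0.
  exact: (psumr_eq0P (fun j _ => pos j) h).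
by rewrite mulf_eq0 (negPf wi) subr_eq0 /= => /eqP.
Qed.

End Simplices.

Section VertexScheme.
Variables (R : realType) (d : nat).
Local Notation pt := 'rV[R]_d.
Local Open Scope fset_scope.
Variable C : {fset set pt}.
Hypothesis cC : simplicial_complex C.
Implicit Types (P Q F T : set pt) (s t : {fset set pt}).

Definition vtx P : {fset set pt} :=
  [fset Q in C | `[< (exists p, Q = [set p]%classic) /\ (Q `<=` P)%classic >]].

Lemma vtxP P Q : reflect
  [/\ Q \in C, exists p, Q = [set p]%classic & (Q `<=` P)%classic] (Q \in vtx P).
Proof.
rewrite /vtx !inE; apply: (iffP andP) => [[QC /asboolP[? ?]]//|[QC Q1 QP]].
by split=> //; apply/asboolP.
Qed.

Lemma cell_polyhedral P : P \in C -> polyhedral P.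
Proof. by move=> PC; apply: polytope_polyhedral; case: cC => -[h _ _] _; apply: h. Qed.

(** An affine function equal to [b] on the chosen vertices and to [b - 1] on the others supports
    [conv S] along the wanted face. *)
Lemma simplex_face S (T : pred 'I_(size S)) :
  aff_indep S -> conv S \in C -> (exists i, T i) ->
  exists F, [/\ F \in C, (F `<=` conv S)%classic,
    forall i, F (nth 0 S (i : 'I_(size S))) <-> T i &
    forall i, T =1 pred1 i -> F = [set nth 0 S i]%classic].
Proof.
move=> indS PC [i0 Ti0].
have [c [b cE]] := aff_indep_functional (fun i => if T i then 0 else - 1) indS.
have cb i : dotp c (nth 0 S (i : 'I_(size S))) <= b.
  by rewrite cE; case: ifP => _; rewrite ?addr0 // gerDl lerN10.
have cT i : dotp c (nth 0 S (i : 'I_(size S))) = b <-> T i.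
  rewrite cE; case: (T i); first by rewrite addr0.
  by split=> // /eqP; rewrite -subr_eq0 addrAC subrr add0r oppr_eq0 oner_eq0.
pose F : set pt := fun x => conv S x /\ dotp c x = b.
have FT i : F (nth 0 S (i : 'I_(size S))) <-> T i.
  by rewrite -cT; split=> [[]//|e]; split=> //; apply: conv_nth.
exists F; split=> //; last 2 first.
- by move=> x [].
- move=> i Ti; apply/seteqP; split=> x; last by move=> ->; apply/FT; rewrite Ti /=.
  move=> [[w [w0 [w1 ->]]] e] /=.
  have wE j : j != i -> w j = 0.
    move=> ji; apply/eqP/negPn/negP => /(conv_max w0 w1 cb e)/cT.
    by rewrite Ti /= (negPf ji).
  have wi : w i = 1 by rewrite -w1 (bigD1 i) //= big1 ?addr0.
  by rewrite (bigD1 i) //= big1 ?addr0 ?wi ?scale1r // => j /wE ->; rewrite scale0r.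
have [[_ Cf _] _] := cC; apply: (Cf _ F PC).
  exists c, b; split=> // x [w [w0 [w1 ->]]].
  rewrite dotp_sumr -[b]mul1r -w1 mulr_suml; apply: ler_sum => i _.
  by rewrite dotpZr ler_wpM2l.
by move=> F0; have : F (nth 0 S i0) by [apply/FT]; rewrite F0.
Qed.

(** A 0-cell inside [P] is a face of [P]; the functional supporting [P] there is also maximal at a
    generator of nonzero weight, which must be that point. The converse is [simplex_face] for one
    vertex. *)
Lemma simplex_vtx P : P \in C -> exists S, [/\ aff_indep S, P = conv S &
  forall Q, Q \in vtx P <-> exists i : 'I_(size S), Q = [set nth 0 S i]%classic].
Proof.
move=> PC; have [[_ _ CI] simp] := cC; have [S [indS PS]] := simp P PC.
exists S; split=> // Q; split=> [/vtxP[QC [p Qp] QP]|[i ->]].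
  have [[c [b [cb e]]] _] := CI _ _ PC QC.
  have PQ : (P `&` Q)%classic = Q by apply/seteqP; split=> x; [case|split=> //; apply: QP].
  have /QP Pp : Q p by rewrite Qp.
  rewrite PS in Pp; have [w [w0 [w1 pw]]] := Pp.
  have cp : dotp c p = b.
    have : Q p by rewrite Qp.
    by rewrite -PQ e => -[].
  have [i wi] : exists i, w i != 0.
    apply: contrapT => no; have : \sum_i w i = 0.
      by apply: big1 => i _; apply/eqP/negPn/negP => wi; apply: no; exists i.
    by rewrite w1 => /eqP; rewrite oner_eq0.
  have Pi : P (nth 0 S i) by rewrite PS; apply: conv_nth.
  have ci : dotp c (nth 0 S i) = b.
    apply: (conv_max w0 w1 _ _ wi); last by rewrite -pw.
    by move=> j; apply: cb; rewrite PS; apply: conv_nth.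
  have : Q (nth 0 S i) by rewrite -PQ e.
  by rewrite Qp => /= ip; exists i; rewrite ip.
rewrite PS in PC *.
have [|F [FC FS FT F1]] := @simplex_face S (pred1 i) indS PC; first by exists i; apply: eqxx.
have FE := F1 i (frefl _); apply/vtxP; rewrite -FE; split=> //.
by exists (nth 0 S i).
Qed.

Lemma vtx_neq0 P : P \in C -> P != set0 -> vtx P != fset0.
Proof.
move=> PC /set0P[x Px]; have [S [_ PS h]] := simplex_vtx PC.
move: Px; rewrite {1}PS => -[w [_ [w1 _]]]; have [i _] : exists i : 'I_(size S), true.
  case: (S) w w1 => [|s S' w _]; last by exists ord0.
  by move=> w; rewrite big_ord0 => /eqP; rewrite eq_sym oner_eq0.
by apply/fset0Pn; exists [set nth 0 S i]%classic; apply/h; exists i.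
Qed.

Lemma vtx_sub P Q : P \in C -> Q \in C -> vtx P `<=` vtx Q <-> (P `<=` Q)%classic.
Proof.
move=> PC QC; split=> [sub|PQ]; last first.
  apply/fsubsetP => A /vtxP[AC A1 AP]; apply/vtxP; split=> //.
  by move=> x /AP/PQ.
have [S [_ PS h]] := simplex_vtx PC; rewrite {1}PS.
apply: conv_sub_polyhedral (cell_polyhedral QC) _ => i.
have /(fsubsetP sub)/vtxP[_ _] : [set nth 0 S i]%classic \in vtx P by apply/h; exists i.
exact.
Qed.

Lemma vtx_inj P Q : P \in C -> Q \in C -> vtx P = vtx Q -> P = Q.
Proof.
by move=> PC QC e; apply/seteqP; split; apply/vtx_sub; rewrite // e.
Qed.

Lemma vertex_schemeP s : reflect (exists P, [/\ P \in C, P != set0 & s = vtx P])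
  (s \in vertex_scheme C).
Proof.
rewrite /vertex_scheme; apply: (iffP (imfsetP _ _ _ _)) => [[P /=]|[P [PC P0 ->]]].
  by rewrite !inE => /andP[PC P0] ->; exists P.
by exists P => //=; rewrite !inE PC.
Qed.

Lemma face_closed_vertex_scheme : face_closed (vertex_scheme C).
Proof.
split; first by apply/vertex_schemeP => -[P [PC P0 e]]; have := vtx_neq0 PC P0; rewrite -e eqxx.
move=> _ t /vertex_schemeP[P [PC P0 ->]] ts t0; apply/vertex_schemeP.
have [S [indS PS h]] := simplex_vtx PC.
pose T (i : 'I_(size S)) := [set nth 0 S i]%classic \in t.
have T0 : exists i, T i.
  have /fset0Pn[Q Qt] := t0; have /h[i Qi] := fsubsetP ts _ Qt.
  by exists i; rewrite /T -Qi.
rewrite PS in PC; have [F [FC FS FT _]] := simplex_face indS PC T0.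
exists F; split=> //.
  by have [i /FT Fi] := T0; apply/set0P; exists (nth 0 S i).
apply/fsetP => Q; apply/idP/vtxP => [Qt|[QC Q1 QF]].
  have Qv := fsubsetP ts _ Qt; have /vtxP[QC Q1 _] := Qv; split=> //.
  have /h[i Qi] := Qv; move=> x; rewrite Qi => ->; apply/FT.
  by rewrite /T -Qi.
have /h[i Qi] : Q \in vtx P by apply/vtxP; split=> // x /QF/FS; rewrite PS.
by move: (Qi) => ->; apply/FT/QF; rewrite Qi.
Qed.

Lemma nonevasive_sd_vertex_scheme : star_shaped (underlying C) ->
  nonevasive (sd (vertex_scheme C)).
Proof.
move=> [x xC star]; set K := vertex_scheme C.
(* Inverse of [vtx]: the geometric cell whose vertex set is [s]. *)
pose G s : set pt := fun y => exists P, [/\ P \in C, P != set0, vtx P = s & P y].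
have GE P : P \in C -> P != set0 -> G (vtx P) = P.
  move=> PC P0; apply/seteqP; split=> y; last by exists P.
  by move=> [Q [QC _ /(vtx_inj QC PC) -> ]].
have ne P y : P y -> P != set0 by move=> Py; apply/set0P; exists y.
have supE : cell_union K G = underlying C.
  apply/seteqP; split=> y; first by move=> [s _ [P [PC _ _ Py]]]; exists P.
  move=> [P PC Py]; exists (vtx P); first by apply/vertex_schemeP; exists P; rewrite (ne _ y).
  by rewrite GE ?(ne _ y).
apply: (@star_nonevasive R d _ _ _ _ K G x).
- by [].
- by move=> s1 s2 s3; apply: fsubset_trans.
- by move=> s /vertex_schemeP[P [PC P0 ->]]; rewrite GE //; apply: cell_polyhedral.
- by move=> s /vertex_schemeP[P [PC P0 ->]]; rewrite GE //; apply/set0P.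
- move=> y; rewrite supE => /(polytopal_carrier (proj1 cC))[k [kC ky kj]].
  exists (vtx k); first by apply/vertex_schemeP; exists k; rewrite (ne _ y).
  move=> s /vertex_schemeP[P [PC P0 ->]]; rewrite GE // vtx_sub //; exact: kj.
- by rewrite supE.
Qed.

Local Open Scope ring_scope.

(** The edge [E] meets [T] in a face of [E]. Its functional [f] takes the supporting value at [v]
    and at a second point of the edge, hence by affinity at [c]. *)
Lemma edge_in_face T (v c : set pt) (pv pc : pt) (e : R) :
  T \in C -> v = [set pv]%classic -> c = [set pc]%classic ->
  [fset v; c] \in vertex_scheme C -> v \in vtx T -> 0 < e -> e <= 1 ->
  T (pv + e *: (pc - pv)) -> c \in vtx T.
Proof.
move=> TC vE cE /vertex_schemeP[E [EC E0 EE]] /vtxP[vC _ vT] e0 e1 Te.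
have vE' : v \in vtx E by rewrite -EE !inE eqxx.
have cE' : c \in vtx E by rewrite -EE !inE eqxx orbT.
have [[_ _ CI] _] := cC; have [[f [b [fb EQ]]] _] := CI _ _ EC TC.
have Ev : E pv by case/vtxP: vE' => _ _; apply; rewrite vE.
have Ec : E pc by case/vtxP: cE' => _ _; apply; rewrite cE.
have Tv : T pv by apply: vT; rewrite vE.
have fv : dotp f pv = b by have : (E `&` T)%classic pv by []; rewrite EQ => -[].
have Ee : E (pv + e *: (pc - pv)).
  have -> : pv + e *: (pc - pv) = (1 - e) *: pv + e *: pc.
    by apply/rowP => i; rewrite !mxE; ring.
  by apply: (polyhedral_convex (cell_polyhedral EC)); rewrite // (ltW e0).
have fe : dotp f (pv + e *: (pc - pv)) = b.
  by have : (E `&` T)%classic (pv + e *: (pc - pv)) by []; rewrite EQ => -[].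
have fc : dotp f pc = b.
  move: fe; rewrite dotpDr dotpZr dotpBr fv => /eqP.
  by rewrite -subr_eq0 addrAC subrr add0r mulf_eq0 gt_eqF //= subr_eq0 => /eqP.
have Tc : (E `&` T)%classic pc by rewrite EQ.
case/vtxP: cE' => cC' c1 _; apply/vtxP; split=> //.
by move=> y; rewrite cE => ->; case: Tc.
Qed.

End VertexScheme.

(** * Simplicial complexes in the plane *)

Section Plane.
Variable R : realType.
Implicit Types (x y s : R) (p q u w : 'rV[R]_2).

(** An open half plane with one of its two bounding rays added: it contains exactly one of any
    nonzero vector and its opposite. *)
Definition lexpos x y : Prop := 0 < x \/ (x = 0 /\ 0 < y).

(** Writing cij for the cross product of vectors i and j, the identity
    [x2 * c13 = x1 * c23 + x3 * c12] decides the sign; vectors on the bounding ray are treated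
    apart. *)
Lemma lexpos_cross_trans x1 y1 x2 y2 x3 y3 :
  lexpos x1 y1 -> lexpos x2 y2 -> lexpos x3 y3 ->
  0 < x1 * y2 - y1 * x2 -> 0 < x2 * y3 - y2 * x3 -> 0 < x1 * y3 - y1 * x3.
Proof.
move=> h1 h2 h3 c12 c23.
have x10 : 0 <= x1 by case: h1 => [/ltW|[->]].
have x30 : 0 <= x3 by case: h3 => [/ltW|[->]].
case: h2 => [x2_gt0|[x20 y20]]; last first.
  by move: c23; rewrite x20; nra.
rewrite -(pmulr_rgt0 _ x2_gt0).
have -> : x2 * (x1 * y3 - y1 * x3) =
    x1 * (x2 * y3 - y2 * x3) + x3 * (x1 * y2 - y1 * x2) by ring.
have [x1_gt0|] := ltP 0 x1.
  by apply: ltr_wpDr; [apply: mulr_ge0 => //; apply: ltW|apply: mulr_gt0].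
move=> x1le; have x1E : x1 = 0 by apply/eqP; rewrite eq_le x1le.
have y1_gt0 : 0 < y1 by case: h1 => [|[]//]; rewrite x1E ltxx.
by move: c12; rewrite x1E; nra.
Qed.

Lemma lexpos_parallel x1 y1 x2 y2 : lexpos x1 y1 -> lexpos x2 y2 ->
  x1 * y2 - y1 * x2 = 0 -> exists2 l, 0 < l & x2 = l * x1 /\ y2 = l * y1.
Proof.
move=> h1 h2 c; case: h1 => [x1_gt0|[x10 y1_gt0]].
  have x2_gt0 : 0 < x2.
    case: h2 => // -[x20 y2_gt0]; move: c; rewrite x20; nra.
  exists (x2 / x1); first exact: divr_gt0.
  split; first by rewrite divfK // gt_eqF.
  have x1n : x1 != 0 by rewrite gt_eqF.
  apply: (mulfI x1n).
  have -> : x1 * (x2 / x1 * y1) = x2 * y1 by field; rewrite gt_eqF.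
  lra.
have x20 : x2 = 0.
  by move/eqP: c; rewrite x10 mul0r sub0r oppr_eq0 mulf_eq0 gt_eqF //= => /eqP.
have y2_gt0 : 0 < y2 by case: h2 => [|[]//]; rewrite x20 ltxx.
exists (y2 / y1); first exact: divr_gt0.
by rewrite x10 x20 mulr0 divfK // gt_eqF.
Qed.

Definition cross u w : R := u 0 0 * w 0 1 - u 0 1 * w 0 0.

(** Vertices of the scheme are singletons, from which this recovers the point; 0 is the default for
    the empty set. *)
Definition pos (Q : set 'rV[R]_2) : 'rV[R]_2 := xget 0 Q.

Lemma pos1 p : pos [set p]%classic = p.
Proof. by rewrite /pos; case: xgetP => [q _ //|/(_ p)]; case. Qed.

(* s = 1 gives the lexicographic order, s = -1 its converse. *)
Definition lexlt s (a b : set 'rV[R]_2) : Prop :=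
  lexpos (s * (pos b - pos a) 0 0) (s * (pos b - pos a) 0 1).

Definition angle (v a b : set 'rV[R]_2) : Prop :=
  0 < cross (pos a - pos v) (pos b - pos v).

Lemma vec2P u w : u 0 0 = w 0 0 -> u 0 1 = w 0 1 -> u = w.
Proof.
move=> h0 h1; apply/rowP => -[[|[|//]] i].
  by rewrite (_ : Ordinal i = 0) //; apply: val_inj.
by rewrite (_ : Ordinal i = 1) //; apply: val_inj.
Qed.

Lemma polyhedral_comb3 (G : set 'rV[R]_2) p q u (a b c : R) : polyhedral G ->
  G p -> G q -> G u -> 0 <= a -> 0 <= b -> 0 <= c -> a + b + c = 1 ->
  G (a *: p + b *: q + c *: u).
Proof.
case=> L -> Gp Gq Gu a0 b0 c0 abc k kL; rewrite !dotpE -[k.2]mul1r -abc !mulrDl.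
by apply: lerD; [apply: lerD|]; apply: ler_wpM2l => //; [apply: Gp|apply: Gq|apply: Gu].
Qed.

Section Planarity.
Variable C : {fset set 'rV[R]_2}.
Hypothesis cC : simplicial_complex C.
Let K := vertex_scheme C.
Let cK : face_closed K := face_closed_vertex_scheme cC.

Lemma is_vertexE Q : is_vertex K Q -> Q = [set pos Q]%classic.
Proof.
move=> /(vertex_schemeP C)[P [PC P0 e]].
have /vtxP[_ [p ->] _] : Q \in vtx C P by rewrite -e fset11.
by rewrite pos1.
Qed.

Lemma pos_inj a b : is_vertex K a -> is_vertex K b -> pos a = pos b -> a = b.
Proof. by move=> /is_vertexE {2}-> /is_vertexE {2}-> ->. Qed.

(** The hypothesis on all polyhedra [T] places a point of the edge in the convex hull of the points
    of [t], hence in the cell of [t], and [edge_in_face] applies. *)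
Lemma edge_in_cell (t : {fset set 'rV[R]_2}) v c (e : R) :
  t \in K -> v \in t -> [fset v; c]%fset \in K -> 0 < e -> e <= 1 ->
  (forall T, polyhedral T -> (forall a, a \in t -> T (pos a)) ->
     T (pos v + e *: (pos c - pos v))) -> c \in t.
Proof.
move=> tK vt vcK e0 e1 h; have /(vertex_schemeP C)[T [TC T0 tT]] := tK.
have vK : is_vertex K v by apply: face_vertex cK vcK _; rewrite !inE eqxx.
have cK' : is_vertex K c by apply: face_vertex cK vcK _; rewrite !inE eqxx orbT.
rewrite tT; apply: (edge_in_face cC TC (is_vertexE vK) (is_vertexE cK') vcK _ e0 e1).
  by rewrite -tT.
apply: h; first exact: (cell_polyhedral cC).
move=> a as_; have aK := face_vertex cK tK as_.
by move: as_; rewrite tT => /vtxP[_ _]; apply; rewrite {1}(is_vertexE aK).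
Qed.

(** Two edges leaving [v] along one ray overlap, which puts [b] among the vertices of the edge to
    [a]. *)
Lemma cross_half_line s v a b : s = 1 \/ s = - 1 ->
  [fset v; a]%fset \in K -> [fset v; b]%fset \in K ->
  lexlt s v a -> lexlt s v b -> b <> v ->
  cross (pos a - pos v) (pos b - pos v) = 0 -> a = b.
Proof.
move=> s1 vaK vbK la lb bv cr.
have cs : (s * (pos a - pos v) 0 0) * (s * (pos b - pos v) 0 1) -
    (s * (pos a - pos v) 0 1) * (s * (pos b - pos v) 0 0) = 0.
  by rewrite -(mulr0 (s * s)) -cr /cross; ring.
have s0 : s != 0 by case: s1 => ->; rewrite ?oppr_eq0 oner_eq0.
have [l l0 [l1 l2]] := lexpos_parallel la lb cs.
have bE : pos b - pos v = l *: (pos a - pos v).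
  by apply: vec2P; apply: (mulfI s0); rewrite ?l1 ?l2 [in RHS]mxE mulrCA.
have : b \in [fset v; a]%fset.
  (* [b] is [l] times as far from [v] as [a]; this [e] gives the point [l / (1 + l)] of the way to
     [a]. *)
  apply: (edge_in_cell (v := v) (e := (1 + l)^-1)) => //.
  - by rewrite !inE eqxx.
  - by rewrite invr_gt0; lra.
  - by rewrite invf_le1 //; lra.
  - move=> T pT hT; rewrite bE scalerA.
    have -> : pos v + ((1 + l)^-1 * l) *: (pos a - pos v) =
        (1 - (1 + l)^-1 * l) *: pos v + ((1 + l)^-1 * l) *: pos a.
      by apply/rowP => i; rewrite !mxE; ring.
    have l10 : 0 < 1 + l by lra.
    apply: (polyhedral_convex pT); [apply: hT|apply: hT|]; rewrite ?inE ?eqxx ?orbT //.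
    apply/andP; split; first by rewrite mulr_ge0 ?invr_ge0 // ltW.
    by rewrite ler_pdivrMl // mulr1; lra.
by rewrite !inE => /orP[/eqP//|/eqP].
Qed.

(** If [c] were angularly between the ends of an edge [a b] of the link, the edge from [v] to [c]
    would enter the triangle [v a b], so [c] would be one of its vertices. *)
Lemma fan_lexlt s v : s = 1 \/ s = - 1 -> fan (lexlt s) angle K v.
Proof.
move=> s1; have ss : s * s = 1 by case: s1 => ->; rewrite ?mulrNN mulr1.
have up a : is_vertex (uplink (lexlt s) K v) a ->
    [/\ is_vertex K a, a <> v, [fset v; a]%fset \in K & lexlt s v a].
  move=> /uplinkP[/link_vertexP[aK /eqP av vaK] h]; split=> //.
  by apply: h; rewrite fset11.
have scale a b : cross (pos a - pos v) (pos b - pos v) =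
    (s * (pos a - pos v) 0 0) * (s * (pos b - pos v) 0 1) -
    (s * (pos a - pos v) 0 1) * (s * (pos b - pos v) 0 0).
  by rewrite /cross -[LHS]mul1r -ss; ring.
have tr a b c : is_vertex (uplink (lexlt s) K v) a -> is_vertex (uplink (lexlt s) K v) b ->
    is_vertex (uplink (lexlt s) K v) c -> angle v a b -> angle v b c -> angle v a c.
  move=> /up[_ _ _ la] /up[_ _ _ lb] /up[_ _ _ lc].
  by rewrite /angle !scale; apply: lexpos_cross_trans.
have irr a : ~ angle v a a.
  by rewrite /angle /cross mulrC subrr ltxx.
split; first split=> //.
- move=> a b /up[aK av vaK la] /up[bK bv vbK lb] ab.
  have [h|h|h] := ltgtP (cross (pos a - pos v) (pos b - pos v)) 0; last 1 first.
  + by case: ab; apply: (cross_half_line s1 vaK vbK la lb bv h).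
  + by right; move: h; rewrite /angle /cross; lra.
  + by left.
move=> a b c abU cU ac cb.
have cU' := face_closed_uplink (lexlt s) v cK.
have aU : is_vertex (uplink (lexlt s) K v) a by apply: face_vertex cU' abU _; rewrite !inE eqxx.
have bU : is_vertex (uplink (lexlt s) K v) b by apply: face_vertex cU' abU _; rewrite !inE eqxx orbT.
have ab := tr _ _ _ aU cU bU ac cb.
have [_ cv vcK _] := up _ cU.
move: abU => /uplinkP[+ _]; rewrite in_link => /and3P[_ _ vabK].
have : c \in (v |` [fset a; b])%fset.
  move: ac cb ab; rewrite /angle; set D := cross (pos a - pos v) (pos b - pos v).
  set A := cross (pos c - pos v) (pos b - pos v); set B := cross (pos a - pos v) (pos c - pos v).
  move=> B0 A0 D0.
  (* Cramer's rule in the plane. *)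
  have cE : D *: (pos c - pos v) = A *: (pos a - pos v) + B *: (pos b - pos v).
    by apply: vec2P; rewrite /D /A /B /cross !mxE; ring.
  have S0 : 0 < A + B + D by lra.
  (* With this [e] the barycentric coordinates at [v], [a] and [b] are proportional to [D], [A] and
     [B]. *)
  apply: (edge_in_cell (v := v) (e := D / (A + B + D))) => //.
  - by rewrite !inE eqxx.
  - exact: divr_gt0.
  - by rewrite ler_pdivrMr // mul1r; lra.
  move=> T pT hT; rewrite mulrC -scalerA cE.
  have -> : pos v + (A + B + D)^-1 *: (A *: (pos a - pos v) + B *: (pos b - pos v)) =
      (D / (A + B + D)) *: pos v + (A / (A + B + D)) *: pos a + (B / (A + B + D)) *: pos b.
    by apply/rowP => i; rewrite !mxE; field; rewrite gt_eqF.
  apply: polyhedral_comb3 => //; try (by apply: hT; rewrite !inE eqxx ?orbT);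
    try (by apply: divr_ge0; apply: ltW).
  by field; rewrite gt_eqF.
rewrite !inE => /or3P[/eqP//|/eqP ca|/eqP cb'].
  by apply: (irr a); move: ac; rewrite ca.
by apply: (irr b); move: cb; rewrite cb'.
Qed.

Lemma planar_vertex_scheme : planar (lexlt 1) angle K.
Proof.
have one : (1 : R) = 1 \/ (1 : R) = - 1 by left.
have mone : (- 1 : R) = 1 \/ (- 1 : R) = - 1 by right.
split; last 2 first.
- by move=> v; apply: fan_lexlt.
- move=> v; apply: linear_forestW (fan_lexlt v mone).
  apply/fsubsetP => t /uplinkP[tl h]; apply/uplinkP; split=> // a /h.
  by rewrite /lexlt !mxE !mul1r !mulN1r !opprB.
split.
- move=> a b c _ _ _; rewrite /lexlt /lexpos !mxE !mul1r => h1 h2.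
  by case: h1 => [h1|[h1 h1']]; case: h2 => [h2|[h2 h2']];
    [left; lra|left; lra|left; lra|right; split; lra].
- by move=> a _; rewrite /lexlt /lexpos subrr !mxE mulr0 ltxx => -[|[]].
- move=> a b aK bK ab; rewrite /lexlt /lexpos !mxE !mul1r.
  have [h|h|h] := ltgtP (pos a 0 0) (pos b 0 0).
  + by left; left; lra.
  + by right; left; lra.
  have [h'|h'|h'] := ltgtP (pos a 0 1) (pos b 0 1).
  + by left; right; split; lra.
  + by right; right; split; lra.
  by case: ab; apply: pos_inj => //; apply: vec2P.
Qed.

Lemma nonevasive_vertex_scheme : star_shaped (underlying C) -> nonevasive K.
Proof.
move=> star; have nsd := nonevasive_sd_vertex_scheme cC star.
have csd : face_closed (sd K) by apply: face_closed_order_complex.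
apply: planar_nonevasive cK planar_vertex_scheme _ _.
  exact: connected_sd cK (nonevasive_connected nsd).
by rewrite -chi_sd // (nonevasive_chi csd nsd).
Qed.

End Planarity.
End Plane.

(* sd^{d-2} C : for a polytopal complex (d >= 3) this is sd^{d-3} (sd C);
   for a simplicial complex in R^2 it is C itself. *)
Theorem theorem2p2 (R : realType) (d : nat) (C : {fset set 'rV[R]_d}) :
  star_shaped (underlying C) ->
  ((3 <= d)%N -> polytopal_complex C ->
     sd_holds nonevasive_and_collapsible (d - 3) (sd_polytopal C)) /\
  (d = 2%N -> simplicial_complex C ->
     nonevasive_and_collapsible (vertex_scheme C)).
Proof.
move=> star; split=> [_ cC|d2 cC].
  apply: sd_holds_nonevasive; first exact: face_closed_order_complex.
  exact: nonevasive_sd_polytopal.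
subst d; have nK := nonevasive_vertex_scheme cC star.
by split=> //; apply: nonevasive_collapsible nK; apply: face_closed_vertex_scheme.
Qed.
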